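(* Let $\partial R$ be a simple closed curve in $\widehat{\mathbb C}$ bounding the two regions $R_1,R_2$, and let $F\in X_{\partial R}$. If $\Gamma_F$ is a (classical or non-classical) Schottky group and $\partial R$ is contained in a fundamental region of $\Gamma_F$, then $F$ is structurally stable in $X_{\partial R}$.
   Context: $\widehat{\mathbb C}$ is the Riemann sphere. Fix a simple closed curve $\partial R\subset\widehat{\mathbb C}$ and a partition of $\widehat{\mathbb C}$ into two simply connected pieces $R_1,R_2$ with common boundary $\partial R$ (the points of $\partial R$ being assigned to the pieces in a fixed way). $X_{\partial R}$ is the space of maps $F:\widehat{\mathbb C}\to\widehat{\mathbb C}$ such that $F|_{R_1}$ and $F|_{R_2}$ are restrictions of elements of $PSL(2,\mathbb C)$ (Möbius transformations); it is given the topology of $PSL(2,\mathbb C)\times PSL(2,\mathbb C)$ via $F\mapsto(F|_{R_1},F|_{R_2})$. $F\in X_{\partial R}$ is structurally stable if there is a neighborhood $\mathcal N_F$ of $F$ in $X_{\partial R}$ such that for every $F'\in\mathcal N_F$ there is a homeomorphism $h:\widehat{\mathbb C}\to\widehat{\mathbb C}$ with $F'\circ h=h\circ F$. Write $f=F|_{R_1}$, $g=F|_{R_2}$ (extended to $\widehat{\mathbb C}$) and $\Gamma_F=\langle f,g\rangle\subset PSL(2,\mathbb C)$. $\Gamma_F$ being a Schottky group means that there are pairwise disjoint simple closed curves $C_1,C_2,C_3,C_4$ in $\widehat{\mathbb C}$ bounding a common region $\mathcal R$, such that $f$ maps $C_1$ onto $C_2$, sending the domain interior to $C_1$ onto the domain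 exterior to $C_2$, and $g$ maps $C_3$ onto $C_4$, sending the domain interior to $C_3$ onto the domain exterior to $C_4$ (the interior of $C_i$ being the component of $\widehat{\mathbb C}\setminus C_i$ not containing $\mathcal R$). Such a region $\mathcal R$ (an open connected set with boundary $C_1\cup C_2\cup C_3\cup C_4$) is called a fundamental region of $\Gamma_F$. *)

(* Defs.v *)
From HB Require Import structures.
From mathcomp Require Import all_boot all_order all_algebra.
From mathcomp Require Import generic_quotient complex.
From mathcomp Require Import all_classical all_reals all_analysis.

Set Implicit Arguments.
Unset Strict Implicit.
Unset Printing Implicit Defensive.

Import Order.TTheory GRing.Theory Num.Theory.
Import numFieldNormedType.Exports.

Local Open Scope classical_set_scope.
Local Open Scope ring_scope.
Local Open Scope complex_scope.
Local Open Scope quotient_scope.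

(* [R[i]] itself carries no topology in the library; its regular module
   [R[i]^o] carries the one defined by the modulus. *)
Definition riemann_sphere (R : realType) : topologicalType :=
  one_point_compactification (R[i]^o).

Section mobius.
Variable R : realType.
Local Notation sphere := (riemann_sphere R).

(* [None] is the point at infinity. *)
Definition mobius (A : 'M[R[i]^o]_2) (z : sphere) : sphere :=
  match z with
  | None => if A 1 0 == 0 then None else Some (A 0 0 / A 1 0)
  | Some w => if A 1 0 * w + A 1 1 == 0 then None
              else Some ((A 0 0 * w + A 0 1) / (A 1 0 * w + A 1 1))
  end.

Lemma mobiusN (A : 'M[R[i]^o]_2) : mobius (- A) = mobius A.
Proof.
apply/funext => -[w|] /=; rewrite !mxE ?oppr_eq0 ?invrN ?mulrNN //.
by rewrite !mulNr -!opprD oppr_eq0 invrN mulrNN.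
Qed.

Definition sl2 : set 'M[R[i]^o]_2 := [set A | \det A = 1].

Definition sl2_eqpm (A B : sl2) : bool :=
  (set_val A == set_val B) || (set_val A == - set_val B).

Lemma sl2_eqpm_refl : reflexive sl2_eqpm.
Proof. by move=> A; rewrite /sl2_eqpm eqxx. Qed.

Lemma sl2_eqpm_sym : symmetric sl2_eqpm.
Proof. move=> A B; rewrite /sl2_eqpm (eq_sym (set_val A)); congr orb.
by rewrite -eqr_oppLR eq_sym. Qed.

Lemma sl2_eqpm_trans : transitive sl2_eqpm.
Proof.
move=> B A D; rewrite /sl2_eqpm => /orP[] /eqP -> /orP[] /eqP ->;
  by rewrite ?opprK eqxx ?orbT.
Qed.

Definition sl2_eqpm_equiv :=
  EquivRel sl2_eqpm sl2_eqpm_refl sl2_eqpm_sym sl2_eqpm_trans.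

(* PSL(2, C) = SL(2, C) / {1, -1}: [sl2] has the subspace topology of the
   matrices, [psl2] the quotient topology. *)
Definition psl2 := quotient_topology {eq_quot sl2_eqpm_equiv}.
HB.instance Definition _ := Topological.on psl2.
HB.instance Definition _ := Quotient.on psl2.

Definition psl2_fun (p : psl2) : sphere -> sphere :=
  mobius (set_val (repr p : sl2)).

Lemma psl2_funE (A : sl2) : psl2_fun (\pi_psl2 A) = mobius (set_val A).
Proof.
rewrite /psl2_fun; case: piP => B /eqmodP /orP[] /eqP -> //.
by rewrite mobiusN.
Qed.

End mobius.

Section planar_topology.
Variables (R : realType) (T : topologicalType).

Definition boundary (A : set T) : set T := closure A `\` A°.

Definition simple_closed_curve (K : set T) : Prop :=
  exists c : R -> T,
    [/\ {within `[0, 1], continuous c}, c 0 = c 1,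
        {in `[0, 1[ &, injective c} & c @` `[0, 1] = K].

Definition path_in (A : set T) (c : R -> T) : Prop :=
  {within `[0, 1], continuous c} /\ (c @` `[0, 1] `<=` A).

Definition simply_connected (A : set T) : Prop :=
  (forall x y, A x -> A y -> exists c, [/\ path_in A c, c 0 = x & c 1 = y]) /\
  (forall c, path_in A c -> c 0 = c 1 ->
     exists H : R * R -> T,
       [/\ {within `[0, 1] `*` `[0, 1], continuous H},
           H @` (`[0, 1] `*` `[0, 1]) `<=` A,
           (forall t, 0 <= t <= 1 -> H (0, t) = c t),
           (forall t, 0 <= t <= 1 -> H (1, t) = c 0) &
           (forall s, 0 <= s <= 1 -> H (s, 0) = c 0 /\ H (s, 1) = c 0)]).

(* A partition into two simply connected pieces with common boundary [dR].
   Nonempty interiors exclude the degenerate partitions in which one piece is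
   an arc of [dR] (the curve minus one point) and the other is the rest. *)
Definition partition_along (dR R1 R2 : set T) : Prop :=
  [/\ R1 `|` R2 = setT, R1 `&` R2 = set0 &
      forall Ri, Ri = R1 \/ Ri = R2 ->
        [/\ Ri° !=set0, simply_connected Ri & boundary Ri = dR]].

(* The two sides of a curve [K] relative to a region [D] off [K]: the component
   of the complement of [K] that contains [D], and the other one. *)
Definition exterior_domain (D K : set T) : set T :=
  [set x | (~` K) x /\ D `<=` connected_component (~` K) x].

Definition interior_domain (D K : set T) : set T :=
  [set x | (~` K) x /\ ~ (D `<=` connected_component (~` K) x)].

Definition schottky_domain (f g : T -> T) (D K1 K2 K3 K4 : set T) : Prop :=
  [/\ [/\ simple_closed_curve K1, simple_closed_curve K2,
          simple_closed_curve K3 & simple_closed_curve K4],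
      [/\ K1 `&` K2 = set0, K1 `&` K3 = set0 & K1 `&` K4 = set0] /\
      [/\ K2 `&` K3 = set0, K2 `&` K4 = set0 & K3 `&` K4 = set0],
      [/\ open D, connected D & boundary D = K1 `|` K2 `|` K3 `|` K4],
      f @` K1 = K2 /\ f @` interior_domain D K1 = exterior_domain D K2 &
      g @` K3 = K4 /\ g @` interior_domain D K3 = exterior_domain D K4].

Definition homeomorphism (h : T -> T) : Prop :=
  exists k : T -> T,
    [/\ cancel h k, cancel k h, continuous h & continuous k].

End planar_topology.

Section piecewise_mobius.
Variable R : realType.
Local Notation sphere := (riemann_sphere R).

Record pw_mobius (R1 R2 : set sphere) := PwMobius {
  pw_fun :> sphere -> sphere ;
  pw_funP : exists p : psl2 R * psl2 R,
    (forall z, R1 z -> pw_fun z = psl2_fun p.1 z) /\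
    (forall z, R2 z -> pw_fun z = psl2_fun p.2 z) }.

Variables R1 R2 : set sphere.

(* The pair (F|_R1, F|_R2). It is unique as soon as both pieces have at least
   three points, in particular when they have nonempty interiors. *)
Definition pw_pieces (F : pw_mobius R1 R2) : psl2 R * psl2 R :=
  sval (cid (pw_funP F)).

HB.instance Definition _ := gen_eqMixin (pw_mobius R1 R2).
HB.instance Definition _ := gen_choiceMixin (pw_mobius R1 R2).

(* [pw_pieces] is then a bijection onto PSL(2, C) x PSL(2, C), so the initial
   topology is the one transported from the product. *)
HB.instance Definition _ :=
  Topological.copy (pw_mobius R1 R2) (initial_topology pw_pieces).

Definition pw_fst (F : pw_mobius R1 R2) : sphere -> sphere :=
  psl2_fun (pw_pieces F).1.

Definition pw_snd (F : pw_mobius R1 R2) : sphere -> sphere :=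
  psl2_fun (pw_pieces F).2.

Definition fundamental_region (F : pw_mobius R1 R2) (D : set sphere) : Prop :=
  exists K1 K2 K3 K4 : set sphere,
    schottky_domain R (pw_fst F) (pw_snd F) D K1 K2 K3 K4.

(* Schottky with respect to the marked generators F|_R1, F|_R2. *)
Definition schottky (F : pw_mobius R1 R2) : Prop :=
  exists D : set sphere, fundamental_region F D.

Definition structurally_stable (F : pw_mobius R1 R2) : Prop :=
  exists2 N : set (pw_mobius R1 R2), nbhs F N &
    forall F', N F' ->
      exists2 h : sphere -> sphere, homeomorphism h & F' \o h = h \o F.

End piecewise_mobius.

(* Main.v *)
Require Import Defs.
From HB Require Import structures.
From mathcomp Require Import all_boot all_order all_algebra.
From mathcomp Require Import generic_quotient complex.
From mathcomp Require Import all_classical all_reals all_analysis.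
From mathcomp Require Import ring lra.

Import Order.TTheory GRing.Theory Num.Theory.
Import numFieldNormedType.Exports.

Local Open Scope classical_set_scope.
Local Open Scope ring_scope.

(** The pieces [f] and [g] of [F] generate a Schottky group, and the curve [dR]
    lies in a fundamental region. The action of a Schottky group is stable: for
    [f'] and [g'] close to [f] and [g] there is a homeomorphism [h] of the sphere
    with [h f = f' h] and [h g = g' h], and it can be chosen to be the identity
    near any given closed part of the fundamental region, here near [dR]
    (lemma [schottky_stability]). As the boundary of both pieces of the
    partition is [dR], such an [h] maps each piece to itself
    ([fix_boundary_preserves]), and [h F = F' h] follows piece by piece.

    To build [h], view the group as a ping-pong system. Each letter of the free
    group has a closed side, a curve together with its interior; the four sides
    are disjoint, and a letter maps everything outside of its own side into
    the side of its inverse. The disjointness of the sides comes from the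
    connectedness of the sphere ([interiors_disjoint]). A point then has an
    itinerary, the word read off the sides that it visits; the itinerary is
    finite if the orbit reaches the closed fundamental domain (the core), and
    infinite if the point is a limit point.

    On the core, [h] is a map [h0] which equals [f' f^-1] or [g' g^-1] on the
    sides of the inverse letters and is the identity away from these sides. As
    [f' f^-1] and [g' g^-1] are close to the identity, multiplying their
    displacement by a Lipschitz cutoff function gives a homeomorphism of the
    whole sphere ([perturbation_homeo]). Since [h0] respects the pairings of the
    curves, it extends equivariantly to all the points with a finite itinerary,
    and limit points are sent to the points with the same itinerary for [f'] and
    [g'] ([ping_pong_conjugacy]). That this defines a homeomorphism rests on one
    fact: the set of the points whose itinerary starts with a given word shrinks
    to a point as the word grows ([mobius_shrinking]). After infinity has been
    moved into the fundamental region, the diameter of this set is at most of order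
    [1 / |c|^2], with [c] the lower left entry of the matrix of the word, and [c]
    is unbounded because the poles of the successive words are centres of discs
    of radius of order [1 / |c|^2] that contain no later pole. *)

Set Implicit Arguments.
Unset Strict Implicit.
Unset Printing Implicit Defensive.

(** * Ping-pong systems and their symbolic coding *)

Lemma closure_mapP (T T' : topologicalType) (f : T -> T') (A : set T)
    (A' : set T') (x : T) :
  {for x, continuous f} -> (forall z, A z -> A' (f z)) ->
  closure A x -> closure A' (f x).
Proof.
move=> fx fA clx V /fx Vfx; have [z [Az Vz]] := clx _ Vfx.
by exists (f z); split=> //; exact: fA.
Qed.

Section ping_pong.
Variables (T : topologicalType) (I : finType) (inv : I -> I).
Hypothesis invK : involutive inv.
Implicit Types (e : I -> T -> T) (B : I -> set T) (w : seq I).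

(** The interior of the side [B i], described dynamically: the part that [e i]
    moves out of the side of the inverse letter. *)
Definition petal e B i : set T := [set x | ~ B (inv i) (e i x)].

Record ping_pong e B : Prop := PingPong {
  pp_cont : forall i, continuous (e i) ;
  pp_inv : forall i x, e (inv i) (e i x) = x ;
  pp_closed : forall i, closed (B i) ;
  pp_disj : forall i j x, B i x -> B j x -> i = j ;
  pp_petal : forall i, petal e B i `<=` B i }.

Fixpoint along e w x := if w is i :: w' then along e w' (e i x) else x.

Fixpoint cylinder e B w : set T :=
  if w is i :: w' then [set x | petal e B i x /\ cylinder e B w' (e i x)]
  else setT.

(** A closed fundamental domain, including the rims [B i `\` petal i] of all the
    sides. *)
Definition core e B : set T := [set x | forall i, ~ petal e B i x].

Definition limit_set e B : set T :=
  [set x | forall n, exists2 w, size w = n & cylinder e B w x].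

(** This makes an itinerary determine a limit point and gives continuity there. *)
Definition shrinking e B := forall y, limit_set e B y ->
  forall V, nbhs y V -> exists2 w, cylinder e B w y & cylinder e B w `<=` V.

Section one_system.
Variables (e : I -> T -> T) (B : I -> set T).
Hypothesis eB : ping_pong e B.

Lemma pp_invr i x : e i (e (inv i) x) = x.
Proof. by rewrite -{1}(invK i) (pp_inv eB). Qed.

Lemma open_petal i : open (petal e B i).
Proof.
have /continuousP ci := pp_cont eB (i := i).
exact: ci (closed_openC (pp_closed eB (i := inv i))).
Qed.

Lemma open_cylinder w : open (cylinder e B w).
Proof.
elim: w => [|i w IHw] /=; first exact: openT.
apply: openI; first exact: open_petal.
by have /continuousP := pp_cont eB (i := i); exact.
Qed.

Lemma petal_inj i j x : petal e B i x -> petal e B j x -> i = j.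
Proof. by move=> /(pp_petal eB) ? /(pp_petal eB); exact: (pp_disj eB). Qed.

Lemma itinerary_prefix w w' x : cylinder e B w x -> cylinder e B w' x ->
  (size w <= size w')%N -> prefix w w'.
Proof.
elim: w w' x => [|i w IHw] w' x; first by rewrite prefix0s.
case: w' => [//|j w'] /= [Ui cw] [Uj cw'] sw.
by move: cw'; rewrite -(petal_inj Ui Uj) eqxx => cw'; exact: IHw cw cw' sw.
Qed.

Lemma cylinder_rcons w i x :
  cylinder e B (rcons w i) x <->
  cylinder e B w x /\ petal e B i (along e w x).
Proof.
elim: w x => [|j w IHw] x /=; first by split=> -[].
split=> [[Ux /IHw[]//]|[[Ux Uw] Ui]]; split=> //; exact/IHw.
Qed.

Lemma cylinder_prefix w w' : prefix w w' ->
  cylinder e B w' `<=` cylinder e B w.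
Proof.
elim: w w' => [//|i w IHw] [//|j w'] /=.
by case: eqP => // <- /IHw sub y [Uy /sub].
Qed.

Lemma core_or_limit x :
  (exists2 w, cylinder e B w x & core e B (along e w x)) \/ limit_set e B x.
Proof.
have [?|nex] := pselect (exists2 w, cylinder e B w x & core e B (along e w x)).
  by left.
right; elim=> [|n [w wn cw]]; first by exists [::].
have : ~ core e B (along e w x) by move=> ?; apply: nex; exists w.
move=> /existsNP[i /contrapT Ui]; exists (rcons w i).
  by rewrite size_rcons wn.
exact/cylinder_rcons.
Qed.

(** A point of a cylinder of a word [j k ...] is moved by [e j] into the petal
    [k], hence [k] differs from [inv j]: the closed sets [B k] and [B (inv j)]
    are disjoint, so that the condition of being in the petal [j] survives in
    the closure. *)
Lemma closure_cylinder w i x : cylinder e B (rcons w i) x ->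
  closure (cylinder e B (rcons w i)) `<=` cylinder e B w.
Proof.
elim: w x => [//|j w IHw] x [Ujx cx] y cly /=.
have cle : closure (cylinder e B (rcons w i)) (e j y).
  by apply: closure_mapP cly => [|z [_]//]; exact: (pp_cont eB).
split; last exact: IHw cx _ cle.
have [k [w' kw]] : exists k w', rcons w i = k :: w'.
  by case: (w) => [|k w']; [exists i, [::]|exists k, (rcons w' i)].
have {}cx : cylinder e B (rcons w i) (e j x) := cx.
rewrite kw in cx cle; have [Uk _] := cx.
have Bk : B k (e j y).
  rewrite ((closure_id _).1 (pp_closed eB (i := k))).
  by apply: closureS cle => z [/(pp_petal eB)].
move=> /(pp_disj eB Bk) kj; apply: Ujx.
by rewrite -kj; exact: (pp_petal eB Uk).
Qed.

(** Since cylinders shrink to points, a map that respects the coding by petals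
    is determined by its values on the core. *)
Lemma coding_rigid (phi : T -> T) : hausdorff_space T -> shrinking e B ->
  (forall i x, phi (e i x) = e i (phi x)) ->
  (forall i x, petal e B i x -> petal e B i (phi x)) ->
  (forall x, core e B x -> phi x = x) -> phi = id.
Proof.
move=> hT sh phie phiU phi1.
have phic w x : cylinder e B w x -> cylinder e B w (phi x).
  elim: w x => [//|i w IHw] x [/phiU Ui /IHw]; rewrite phie => cw; split=> //.
apply/funext => x; have [[w]|lx] := core_or_limit x.
  elim: w x => [|i w IHw] x /=; first by move=> _ /phi1.
  case=> _ cw /(IHw _ cw) /(congr1 (e (inv i))).
  by rewrite phie !(pp_inv eB).
apply: hT => V W Vphi /(sh _ lx)[w /phic cw cW].
by exists (phi x); split; [exact: nbhs_singleton|exact: cW].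
Qed.

End one_system.

Record compatible e B e' B' (h0 : T -> T) : Prop := Compatible {
  cp_cont : continuous h0 ;
  cp_B : forall i x, B' i (h0 x) <-> B i x ;
  cp_petal : forall i x, petal e' B' i (h0 x) <-> petal e B i x ;
  cp_rim : forall i x, B i x -> ~ petal e B i x -> h0 (e i x) = e' i (h0 x) }.

Section two_systems.
Variables (e e' : I -> T -> T) (B B' : I -> set T) (h0 : T -> T).
Hypotheses (eB : ping_pong e B) (eB' : ping_pong e' B').
Hypothesis h0P : compatible e B e' B' h0.
Hypotheses (cT : compact [set: T]) (hT : hausdorff_space T).
Hypothesis shB' : shrinking e' B'.

(** The graph of the conjugacy: [y] has the same itinerary as [x], and when the
    orbit of [x] reaches the core, that of [y] arrives at the image by [h0]. *)
Definition coded (x y : T) := forall w, cylinder e B w x ->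
  cylinder e' B' w y /\
  (core e B (along e w x) -> along e' w y = h0 (along e w x)).

Lemma coded_core x y : coded x y -> core e B x -> y = h0 x.
Proof. by move=> /(_ [::] Logic.I)[_]; exact. Qed.

Lemma coded_petal i x y : coded x y -> petal e B i x -> petal e' B' i y.
Proof. by move=> xy Ux; have [] := xy [:: i] (conj Ux Logic.I) => -[]. Qed.

Lemma coded_step i x y : coded x y -> petal e B i x ->
  coded (e i x) (e' i y).
Proof. by move=> xy Ux w cw; have [] := xy (i :: w) (conj Ux cw) => -[]. Qed.

Lemma petal_pullback i x y : petal e B i x ->
  (forall j, ~ B j (e i x) -> ~ B' j y) ->
  petal e' B' i (e' (inv i) y) /\ forall j, ~ B j x -> ~ B' j (e' (inv i) y).
Proof.
move=> Ux By; have Uy : petal e' B' i (e' (inv i) y).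
  by rewrite /petal /= (pp_invr eB'); exact: By.
split=> // j Bj B'j; apply: Bj.
have B'i := pp_petal eB' Uy.
by rewrite (pp_disj eB' B'j B'i); exact: (pp_petal eB) Ux.
Qed.

(** The last clause makes the induction work: it places the pulled back point
    in the petal of the preceding letter. *)
Lemma coded_ex_core w x : cylinder e B w x -> core e B (along e w x) ->
  exists2 y, coded x y & forall i, ~ B i x -> ~ B' i y.
Proof.
elim: w x => [|i w IHw] x /=.
  move=> _ cx; exists (h0 x) => [[|i w]|i]; [by []| |by rewrite (cp_B h0P)].
  by move=> [/cx].
move=> [Ux cw] /(IHw _ cw)[y xy By]; have [Uy B'y] := petal_pullback Ux By.
exists (e' (inv i) y) => //; case=> [_|j v]; first by split=> // /(_ i).
move=> [Ujx]; rewrite -(petal_inj eB Ux Ujx) => cv.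
by have [cy ey] := xy _ cv; rewrite /= (pp_invr eB').
Qed.

Lemma cylinder_transfer w x : cylinder e B w x ->
  exists2 y, cylinder e' B' w y & forall i, ~ B i x -> ~ B' i y.
Proof.
elim: w x => [|i w IHw] x /=.
  by move=> _; exists (h0 x) => // i; rewrite (cp_B h0P).
move=> [Ux cw]; have [y cy By] := IHw _ cw.
have [Uy B'y] := petal_pullback Ux By; exists (e' (inv i) y) => //.
by rewrite (pp_invr eB').
Qed.

(** For a limit point the corresponding cylinders of the second system are
    nested and nonempty, so they have a common adherent point by compactness;
    it belongs to all of them as the closure of each lies in the one before. *)
Lemma coded_ex x : exists y, coded x y.
Proof.
have [[w cw cx]|lx] := core_or_limit e B x.
  by have [y] := coded_ex_core cw cx; exists y.
have W n : {w | size w = n & cylinder e B w x} by have /cid2 := lx n.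
have WS n : exists i, s2val (W n.+1) = rcons (s2val (W n)) i.
  have := itinerary_prefix eB (s2valP' (W n)) (s2valP' (W n.+1)).
  rewrite !(s2valP (W _)) => /(_ (leqnSn n)) /prefixP[v].
  move: (s2valP (W n.+1)) => /[swap] ->; rewrite size_cat (s2valP (W n)).
  case: v => [|i [|j v]] /=; first by rewrite addn0 => /eqP; rewrite ltn_eqF.
    by exists i; rewrite cats1.
  by rewrite !addnS => /eqP; rewrite !eqSS gtn_eqF// ltnS leq_addr.
have Wsub m n : (m <= n)%N -> prefix (s2val (W m)) (s2val (W n)).
  move=> mn; apply: (itinerary_prefix eB (s2valP' (W m)) (s2valP' (W n))).
  by rewrite !(s2valP (W _)).
have /choice[y_ cy_] n : exists y, cylinder e' B' (s2val (W n)) y.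
  by have [y cy _] := cylinder_transfer (s2valP' (W n)); exists y.
have [y [_ cly]] : [set: T] `&` cluster (y_ @ \oo) !=set0.
  by apply: cT; exact: filterT.
have Wy n : cylinder e' B' (s2val (W n)) y.
  have [i Wi] := WS n; have cyl := cy_ n.+1; rewrite Wi in cyl.
  apply: (closure_cylinder eB' cyl); rewrite -Wi => V Vy.
  have [|z [[m /= nm <-] Vz]] :=
      cly [set y_ m | m in [set m | (n < m)%N]] V _ Vy.
    by exists n.+1 => // m nm; exists m.
  by exists (y_ m); split=> //; apply: cylinder_prefix (cy_ m); exact: Wsub.
have WE w : cylinder e B w x -> w = s2val (W (size w)).
  move=> cw; have := itinerary_prefix eB cw (s2valP' (W (size w))).
  rewrite (s2valP (W _)) => /(_ (leqnn _)) /prefixP[v].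
  move=> /[dup] /(congr1 size); rewrite size_cat (s2valP (W _)).
  case: v => [|i v]; first by rewrite cats0.
  by rewrite addnS => /eqP; rewrite ltn_eqF// ltnS leq_addr.
exists y => w cw; split; first by rewrite (WE _ cw); exact: Wy.
have [i Wi] := WS (size w); have := s2valP' (W (size w).+1).
by rewrite Wi -(WE _ cw) => /cylinder_rcons[_ Ui] /(_ i).
Qed.

Lemma coded_limit x y : coded x y -> limit_set e B x -> limit_set e' B' y.
Proof. by move=> xy lx n; have [w wn /xy[]] := lx n; exists w. Qed.

(** Two points with the coding of a limit point share all their cylinders, which
    shrink to a point. *)
Lemma coded_uniq x y z : coded x y -> coded x z -> y = z.
Proof.
have [[w]|lx] := core_or_limit e B x.
  elim: w x y z => [|i w IHw] x y z /=.
    by move=> _ cx /coded_core-> // /coded_core->.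
  case=> Ux cw cx xy xz.
  have := IHw _ _ _ cw cx (coded_step xy Ux) (coded_step xz Ux).
  by move=> /(congr1 (e' (inv i))); rewrite !(pp_inv eB').
move=> xy xz; apply: hT => V W Vy Wz.
have [w cwy cwV] := shB' (coded_limit xy lx) Vy.
exists z; split; last exact: nbhs_singleton.
apply: cwV; have [w' ww' cw'x] := lx (size w).
have [cw'y _] := xy _ cw'x; have [cw'z _] := xz _ cw'x.
apply: cylinder_prefix cw'z; apply: (itinerary_prefix eB' cwy cw'y).
by rewrite ww'.
Qed.

Definition conjugacy (x : T) : T := sval (cid (coded_ex x)).

Lemma conjugacyP x : coded x (conjugacy x).
Proof. exact: svalP (cid (coded_ex x)). Qed.

Lemma conjugacy_core x : core e B x -> conjugacy x = h0 x.
Proof. exact: coded_core (@conjugacyP x). Qed.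

Lemma conjugacy_petal i x : petal e B i x -> petal e' B' i (conjugacy x).
Proof. exact: coded_petal (@conjugacyP x). Qed.

Lemma conjugacy_step i x : petal e B i x ->
  conjugacy (e i x) = e' i (conjugacy x).
Proof.
move=> Ux; apply: (coded_uniq (@conjugacyP _)).
exact: (coded_step (@conjugacyP _) Ux).
Qed.

Lemma rim_core i x : B i x -> ~ petal e B i x -> core e B x.
Proof.
by move=> Bx Ux j /[dup] /(pp_petal eB) /(pp_disj eB Bx) <-.
Qed.

(** The three positions of [x] relative to [e i]: inside the petal [i], mapped
    by [e i] into the petal [inv i], or on the rim [B i `\` petal i]. *)
Lemma conjugacy_equivariant i x : conjugacy (e i x) = e' i (conjugacy x).
Proof.
have [/conjugacy_step//|nUx] := pselect (petal e B i x).
have [Uex|nUex] := pselect (petal e B (inv i) (e i x)).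
  have := conjugacy_step Uex; rewrite (pp_inv eB) => ->.
  by rewrite (pp_invr eB').
have Bex : B (inv i) (e i x) by exact: contrapT.
have Bx : B i x.
  by apply: contrapT => Bx; apply: nUex; rewrite /petal /= invK (pp_inv eB).
rewrite !conjugacy_core ?(cp_rim h0P)//; first exact: rim_core Bx _.
exact: rim_core Bex _.
Qed.

Lemma near_other_closed i x : B i x ->
  \forall z \near x, forall j, j != i -> ~ B j z.
Proof.
move=> Bx; apply: filter_forall => j.
have [->|ji] := eqVneq j i; first by exact: nearW.
apply: filterS (open_nbhs_nbhs (conj (closed_openC (pp_closed eB (i := j))) _)).
  by move=> z nBz _.
by move=> /(pp_disj eB Bx) /eqP; rewrite eq_sym (negbTE ji).
Qed.

(** Near a rim point the coding involves at most one step: the image by [e i]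
    of a nearby point of the petal [i] lies in the core. *)
Lemma conjugacy_continuous_core x : core e B x ->
  {for x, continuous conjugacy}.
Proof.
move=> cx V; rewrite conjugacy_core// => Vx.
change (\forall z \near x, V (conjugacy z)).
have [[i Bx]|nB] := pselect (exists i, B i x); last first.
  have nBx : \forall z \near x, forall i, ~ B i z.
    apply: filter_forall => i; apply: open_nbhs_nbhs; split.
      exact: closed_openC (pp_closed eB (i := i)).
    by move=> Bx; apply: nB; exists i.
  have Vh0 : \forall z \near x, V (h0 z) by exact: (cp_cont h0P).
  near=> z; rewrite /= conjugacy_core; first by near: z.
  by move=> i /(pp_petal eB); move: i; near: z.
have nUx : ~ petal e B i x by exact: cx.
have Bex : B (inv i) (e i x) by exact: contrapT.
have Vh0 : \forall z \near x, V (h0 z) by exact: (cp_cont h0P).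
have Vh0e : \forall z \near x, V (e' (inv i) (h0 (e i z))).
  have c1 : {for x, continuous (fun z => e' (inv i) (h0 (e i z)))}.
    apply: (@continuous_comp _ _ _ (fun z => h0 (e i z)) (e' (inv i))).
      apply: (@continuous_comp _ _ _ (e i) h0); first exact: (pp_cont eB).
      exact: (cp_cont h0P).
    exact: (pp_cont eB').
  by apply: c1; rewrite (cp_rim h0P)// (pp_inv eB').
have Bz := near_other_closed Bx.
have Bez : \forall z \near x, forall j, j != inv i -> ~ B j (e i z).
  exact: (pp_cont eB) (near_other_closed Bex).
near=> z; rewrite /=.
have [Uz|nUz] := pselect (petal e B i z).
  have -> : conjugacy z = e' (inv i) (conjugacy (e i z)).
    by rewrite conjugacy_equivariant (pp_inv eB').
  rewrite conjugacy_core; first by near: z.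
  move=> j /(pp_petal eB); have [->//|] := eqVneq j (inv i).
  by move: j; near: z.
rewrite conjugacy_core; first by near: z.
move=> j; have [->//|ji] := eqVneq j i; move=> /(pp_petal eB).
by move: j ji; near: z.
Unshelve. all: by end_near. Qed.

(** Continuity at a point that reaches the core follows from continuity on the
    core by equivariance. At a limit point the small cylinders are the
    neighbourhoods to consider, and [conjugacy] maps cylinders to cylinders. *)
Lemma conjugacy_continuous : continuous conjugacy.
Proof.
move=> x; have [[w]|lx] := core_or_limit e B x.
  elim: w x => [|i w IHw] x /=.
    by move=> _; exact: conjugacy_continuous_core.
  case=> Ux cw cx.
  have -> : conjugacy = fun z => e' (inv i) (conjugacy (e i z)).
    by apply/funext => z; rewrite conjugacy_equivariant (pp_inv eB').
  apply: (@continuous_comp _ _ _ (fun z => conjugacy (e i z)) (e' (inv i))).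
    apply: (@continuous_comp _ _ _ (e i) conjugacy); first exact: (pp_cont eB).
    exact: IHw.
  exact: (pp_cont eB').
move=> V /(shB' (coded_limit (@conjugacyP x) lx))[w cwy cwV].
have [w' w'w cw'x] := lx (size w).
have cw'y : cylinder e' B' w' (conjugacy x) by have [] := conjugacyP cw'x.
have : nbhs x (cylinder e B w').
  by apply: open_nbhs_nbhs; split=> //; exact: open_cylinder.
apply: filterS => z cw'z; apply: cwV.
have := (conjugacyP cw'z).1; apply: cylinder_prefix.
by apply: (itinerary_prefix eB' cwy cw'y); rewrite w'w.
Qed.

End two_systems.

(** The inverse of the conjugacy is the conjugacy built from [k0] in the other
    direction: both compositions commute with the letters and are the identity
    on the core, so they are the identity by rigidity. *)
Theorem ping_pong_conjugacy e e' B B' h0 k0 :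
  compact [set: T] -> hausdorff_space T ->
  ping_pong e B -> ping_pong e' B' -> shrinking e B -> shrinking e' B' ->
  cancel h0 k0 -> cancel k0 h0 -> compatible e B e' B' h0 -> continuous k0 ->
  exists h, [/\ homeomorphism h, forall i x, h (e i x) = e' i (h x) &
    forall x, core e B x -> h x = h0 x].
Proof.
move=> cT hT eB eB' sh sh' h0K k0K h0P k0c.
have k0P : compatible e' B' e B k0.
  split=> //.
  - by move=> i y; rewrite -(cp_B h0P) k0K.
  - by move=> i y; rewrite -(cp_petal h0P) k0K.
  - move=> i y; rewrite -[y in B' i y]k0K (cp_B h0P) -[y in petal e' B' i y]k0K.
    by rewrite (cp_petal h0P) => By Uy; rewrite -{1}[y]k0K -(cp_rim h0P)// h0K.
pose h := conjugacy eB eB' h0P cT; pose k := conjugacy eB' eB k0P cT.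
have hcore x : core e B x -> core e' B' (h0 x).
  by move=> cx i /(cp_petal h0P) /cx.
have kcore x : core e' B' x -> core e B (k0 x).
  by move=> cx i /(cp_petal k0P) /cx.
have hK : k \o h = id.
  apply: (coding_rigid eB hT sh) => [i x|i x Ux|x cx] /=.
  - by rewrite /h conjugacy_equivariant// /k conjugacy_equivariant.
  - by do 2!apply: conjugacy_petal.
  - by rewrite /h conjugacy_core// /k conjugacy_core ?h0K//; exact: hcore.
have kK : h \o k = id.
  apply: (coding_rigid eB' hT sh') => [i x|i x Ux|x cx] /=.
  - by rewrite /k conjugacy_equivariant// /h conjugacy_equivariant.
  - by do 2!apply: conjugacy_petal.
  - by rewrite /k conjugacy_core// /h conjugacy_core ?k0K//; exact: kcore.
exists h; split; last by move=> x cx; exact: conjugacy_core.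
  exists k; split; [by move=> x; exact: (congr1 (@^~ x) hK)|
    by move=> x; exact: (congr1 (@^~ x) kK)| |]; exact: conjugacy_continuous.
by move=> i x; exact: conjugacy_equivariant.
Qed.

End ping_pong.

(** * The complex plane with its real-valued modulus *)

Section modulus.
Variable R : realType.
Local Notation C := (R[i]^o).
Implicit Types (z w x y : C) (e M : R).

(** The norm of [R[i]] takes its values in [R[i]], whose order is partial; this
    is the same number, as an element of the ordered field [R]. *)
Definition cabs z : R := Normc.normc z.

Lemma cabsE z : `|z| = (cabs z)%:C%C. Proof. by []. Qed.

Lemma cabs_ge0 z : 0 <= cabs z.
Proof. by rewrite /cabs; case: z => a b /=; exact: sqrtr_ge0. Qed.

Lemma cabs0 : cabs 0 = 0. Proof. exact: Normc.normc0. Qed.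

Lemma cabs1 : cabs 1 = 1. Proof. exact: Normc.normc1. Qed.

Lemma cabsM z w : cabs (z * w) = cabs z * cabs w.
Proof. exact: Normc.normcM. Qed.

Lemma cabsV z : cabs z^-1 = (cabs z)^-1.
Proof. exact: Normc.normcV. Qed.

Lemma cabsN z : cabs (- z) = cabs z.
Proof. exact: normcN. Qed.

Lemma cabsD z w : cabs (z + w) <= cabs z + cabs w.
Proof. exact: le_normcD. Qed.

Lemma cabsC z w : cabs (z - w) = cabs (w - z).
Proof. by rewrite -cabsN opprB. Qed.

Lemma cabs_eq0 z : (cabs z == 0) = (z == 0).
Proof.
by apply/eqP/eqP => [/Normc.eq0_normc//|->]; exact: cabs0.
Qed.

Lemma cabs_gt0 z : (0 < cabs z) = (z != 0).
Proof. by rewrite lt_def cabs_eq0 cabs_ge0 andbT. Qed.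

Lemma cabs_dist z w x : cabs (z - w) <= cabs (z - x) + cabs (x - w).
Proof. by have := cabsD (z - x) (x - w); rewrite addrA subrK. Qed.

Lemma cabs_distD z w : cabs z <= cabs (z - w) + cabs w.
Proof. by have := cabsD (z - w) w; rewrite subrK. Qed.

Lemma cabs_real (a : R) : cabs (a%:C%C : C) = `|a|.
Proof. by rewrite /cabs /= expr0n addr0 sqrtr_sqr. Qed.

Lemma cabs_ReIm z : cabs z <= `|complex.Re z| + `|complex.Im z|.
Proof.
case: z => a b; rewrite /cabs /= -[leRHS]ger0_norm ?addr_ge0//.
rewrite -sqrtr_sqr ler_wsqrtr// sqrrD !real_normK ?num_real//.
by rewrite -addrA lerD2l lerDr mulrn_wge0 // mulr_ge0.
Qed.

Lemma nbhs_planeP z (A : set C) :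
  nbhs z A <-> exists2 e : R, 0 < e & forall w, cabs (w - z) < e -> A w.
Proof.
split=> [[e /= e0 eA]|[e e0 eA]].
  have eE : e = (complex.Re e)%:C%C.
    by case: e e0 {eA} => a b; rewrite ltcE /= => /andP[/eqP-> _].
  exists (complex.Re e); first by rewrite -ltcR -eE.
  by move=> w wz; apply: eA; rewrite /ball_ /= cabsE cabsC eE ltcR.
exists (e%:C%C); first by rewrite /= ltcR.
by move=> w; rewrite /ball_ /= cabsE cabsC ltcR; exact: eA.
Qed.

Lemma closed_disc M : closed [set z : C | cabs z <= M].
Proof.
rewrite -[X in closed X]setCK; apply: open_closedC.
rewrite openE => z /= /negP; rewrite -ltNge => zM; apply/nbhs_planeP.
exists (cabs z - M); first by rewrite subr_gt0.
by move=> w wz /=; have := cabs_distD z w; rewrite (cabsC z); move: wz; lra.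
Qed.

(** A closed subset of the image of a square. *)
Lemma compact_disc M : compact [set z : C | cabs z <= M].
Proof.
pose phi (p : R * R) : C := (p.1 +i* p.2)%C.
have phic : continuous phi.
  move=> [a b] V /nbhs_planeP[e e0 eV].
  have e2 : 0 < e / 2 by rewrite divr_gt0.
  exists (ball a (e / 2), ball b (e / 2)) => /=.
    by split; exact: nbhsx_ballx.
  move=> [x y] [/= ax yb]; apply: eV.
  have /le_lt_trans -> // := cabs_ReIm (phi (x, y) - phi (a, b)).
  by rewrite /= (splitr e) ltrD// distrC.
have sq : compact (`[- M, M]%classic `*` `[- M, M]%classic : set (R * R)).
  by apply: compact_setX; exact: segment_compact.
have cphi := continuous_compact (continuous_subspaceT phic) sq.
apply: (subclosed_compact (@closed_disc M) cphi).
move=> [a b] /= abM; exists (a, b) => //; split; rewrite /= in_itv /=.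
  rewrite -ler_norml; apply: le_trans abM.
  by rewrite /cabs /= -sqrtr_sqr ler_wsqrtr// lerDl sqr_ge0.
rewrite -ler_norml; apply: le_trans abM.
by rewrite /cabs /= -sqrtr_sqr ler_wsqrtr// lerDr sqr_ge0.
Qed.

Lemma compact_planeP (A : set C) : compact A ->
  exists M, forall z, A z -> cabs z <= M.
Proof.
move=> /compact_near_coveringP cA.
have [|M [_ MA]] := cA R (pinfty_nbhs R) (fun M z => cabs z < M) _.
  move=> x Ax.
  exists ([set z | cabs (z - x) < 1], [set M | cabs x + 1 < M]) => /=.
    split; last by exists (cabs x + 1); split => //; rewrite num_real.
    by apply/nbhs_planeP; exists 1.
  move=> [z M] /= [zx xM]; have := cabs_distD z x; lra.
by exists (M + 1) => z Az; apply/ltW/(MA (M + 1)) => //; rewrite ltrDl.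
Qed.

End modulus.

(** * Two-by-two matrices *)

Lemma det2 (K : comNzRingType) (A : 'M[K]_2) :
  \det A = A 0 0 * A 1 1 - A 0 1 * A 1 0.
Proof.
rewrite (expand_det_row A 0) !big_ord_recl big_ord0 addr0.
rewrite /cofactor !det_mx11 !mxE /= expr0 expr1 mul1r mulN1r mulrN.
by congr (_ * _ - _ * _); congr (A _ _); apply/val_inj.
Qed.

Lemma mulmx2E (K : pzRingType) (A B : 'M[K]_2) i j :
  (A *m B) i j = A i 0 * B 0 j + A i 1 * B 1 j.
Proof.
rewrite mxE !big_ord_recl big_ord0 addr0.
by congr (_ + A i _ * B _ j); apply/val_inj.
Qed.

(** * The Riemann sphere and its Moebius transformations *)

Section sphere.
Variable R : realType.
Local Notation C := (R[i]^o).
Local Notation sphere := (riemann_sphere R).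
Local Notation mat := ('M[R[i]^o]_2).
Implicit Types (z w x y : C) (e M : R) (A B : mat) (p q : sphere).

Lemma nbhs_SomeP z (V : set sphere) : nbhs (Some z : sphere) V <->
  exists2 e : R, 0 < e & forall w, cabs (w - z) < e -> V (Some w).
Proof. exact: nbhs_planeP. Qed.

Lemma nbhs_NoneP (V : set sphere) : nbhs (None : sphere) V <->
  V None /\ exists M : R, forall w, M < cabs w -> V (Some w).
Proof.
split=> [[K [/compact_planeP[M KM] _] KV]|[VN [M MV]]].
  split; first by apply: KV; right.
  exists M => w Mw; apply: KV; left; exists w => // /KM.
  by rewrite leNgt Mw.
have cM := @compact_disc R M.
exists [set z : C | cabs z <= M]; first by split; last exact: closed_disc.
move=> [w|] /=; last by [].
by move=> [[w' /= /negP]|//]; rewrite -ltNge => wM [<-]; exact: MV.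
Qed.

Lemma plane_hausdorff : hausdorff_space (R[i]^o).
Proof.
move=> z w zw; apply/eqP; rewrite -subr_eq0 -cabs_eq0; apply/eqP.
apply/le_anti; rewrite cabs_ge0 andbT leNgt; apply/negP => d0.
have d2 : 0 < cabs (z - w) / 2 by rewrite divr_gt0.
have [||x [/= xz xw]] := zw [set x | cabs (x - z) < cabs (z - w) / 2]
    [set x | cabs (x - w) < cabs (z - w) / 2].
- by apply/nbhs_planeP; exists (cabs (z - w) / 2).
- by apply/nbhs_planeP; exists (cabs (z - w) / 2).
have := cabs_dist z w x; rewrite (cabsC z x); move: xz xw; lra.
Qed.

Lemma sphere_hausdorff : hausdorff_space sphere.
Proof.
apply: one_point_compactification_hausdorff plane_hausdorff.
move=> z _; exists [set w : C | cabs w <= cabs z + 1].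
  rewrite withinET; apply/nbhs_planeP; exists 1 => // w wz /=.
  have := cabs_distD w z; move: wz; lra.
have cD := @compact_disc R (cabs z + 1).
split=> //; last exact: compact_closed plane_hausdorff cD.
Qed.

Lemma sphere_compact : compact [set: sphere].
Proof. exact: one_point_compactification_compact. Qed.

(** The point with homogeneous coordinates [x : y]; in these coordinates a
    Moebius transformation is linear, hence the composition law. *)
Definition proj x y : sphere := if y == 0 then None else Some (x / y).

Lemma proj_scale x y (k : C) : k != 0 -> proj (k * x) (k * y) = proj x y.
Proof.
move=> k0; rewrite /proj mulf_eq0 (negbTE k0) /=; case: ifPn => // y0.
by congr Some; rewrite -mulf_div divff// mul1r.
Qed.

Lemma proj_surj p : exists x y, [/\ p = proj x y & (x != 0) || (y != 0)].
Proof.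
case: p => [w|]; [exists w, 1|exists 1, 0]; rewrite /proj ?eqxx oner_eq0//.
by rewrite divr1 orbT.
Qed.

Lemma mobius_proj A x y : (x != 0) || (y != 0) ->
  mobius A (proj x y) = proj (A 0 0 * x + A 0 1 * y) (A 1 0 * x + A 1 1 * y).
Proof.
move=> xy; rewrite {1}/proj; have [y0|y0] := eqVneq y 0.
  move: xy; rewrite y0 eqxx orbF !mulr0 !addr0 => x0.
  by rewrite ![_ * x]mulrC proj_scale.
have -> : A 0 0 * x + A 0 1 * y = y * (A 0 0 * (x / y) + A 0 1) by field.
have -> : A 1 0 * x + A 1 1 * y = y * (A 1 0 * (x / y) + A 1 1) by field.
by rewrite proj_scale.
Qed.

Lemma mobiusM A B p : \det B != 0 ->
  mobius (A *m B) p = mobius A (mobius B p).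
Proof.
rewrite det2 => dB; have [x [y [-> xy]]] := proj_surj p.
rewrite !mobius_proj ?mulmx2E//; first by congr proj; ring.
rewrite -negb_and; apply: contra dB => /andP[/eqP Bx /eqP By].
have [x0|] := boolP (x != 0).
  rewrite -(inj_eq (mulIf x0)) mul0r; apply/eqP.
  transitivity (B 1 1 * (B 0 0 * x + B 0 1 * y)
                - B 0 1 * (B 1 0 * x + B 1 1 * y)).
    by ring.
  by rewrite Bx By; ring.
rewrite negbK => x0; move: xy; rewrite x0 /= => y0.
rewrite -(inj_eq (mulIf y0)) mul0r; apply/eqP.
transitivity (B 0 0 * (B 1 0 * x + B 1 1 * y)
              - B 1 0 * (B 0 0 * x + B 0 1 * y)).
  by ring.
by rewrite Bx By; ring.
Qed.

Lemma mobius1 : mobius (1%:M : mat) = id.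
Proof.
apply/funext => p; have [x [y [-> xy]]] := proj_surj p.
by rewrite mobius_proj// !mxE /= !mul1r !mul0r addr0 add0r.
Qed.

Lemma mobius_adjK A : \det A = 1 -> cancel (mobius A) (mobius (\adj A)).
Proof.
by move=> dA p; rewrite -mobiusM ?dA ?oner_eq0// mul_adj_mx dA mobius1.
Qed.

Lemma det_adj A : \det A = 1 -> \det (\adj A) = 1.
Proof.
move=> dA; have := congr1 determinant (mul_mx_adj A).
by rewrite det_mulmx det_scalar dA expr1n mul1r.
Qed.

Lemma mobius_Kadj A : \det A = 1 -> cancel (mobius (\adj A)) (mobius A).
Proof.
move=> dA p; rewrite -mobiusM ?det_adj ?oner_eq0// mul_mx_adj dA.
by rewrite mobius1.
Qed.

Lemma mobius_sub A z w : \det A = 1 ->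
  A 1 0 * z + A 1 1 != 0 -> A 1 0 * w + A 1 1 != 0 ->
  (A 0 0 * z + A 0 1) / (A 1 0 * z + A 1 1)
  - (A 0 0 * w + A 0 1) / (A 1 0 * w + A 1 1)
  = (z - w) / ((A 1 0 * z + A 1 1) * (A 1 0 * w + A 1 1)).
Proof.
rewrite det2 => dA Dz Dw; rewrite -[z - w]mul1r -[in RHS]dA.
by field; rewrite Dz Dw.
Qed.

Lemma mobius_subNone A w : \det A = 1 ->
  A 1 0 != 0 -> A 1 0 * w + A 1 1 != 0 ->
  A 0 0 / A 1 0 - (A 0 0 * w + A 0 1) / (A 1 0 * w + A 1 1)
  = (A 1 0 * (A 1 0 * w + A 1 1))^-1.
Proof.
rewrite det2 => dA c0 Dw; rewrite -[RHS]mul1r -[in RHS]dA.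
by field; rewrite c0 Dw.
Qed.

End sphere.

Section sphere_topology.
Variable R : realType.
Local Notation C := (R[i]^o).
Local Notation sphere := (riemann_sphere R).
Local Notation mat := ('M[R[i]^o]_2).
Implicit Types (z w x y : C) (A B : mat) (p q : sphere).

Lemma mobius_continuous_fin A z : \det A = 1 -> A 1 0 * z + A 1 1 != 0 ->
  {for (Some z : sphere), continuous (mobius A)}.
Proof.
move=> dA Dz V; rewrite /= (negbTE Dz) => /nbhs_SomeP[e e0 eV].
change (nbhs (Some z : sphere) (mobius A @^-1` V)).
set D := A 1 0 * z + A 1 1 in Dz eV; have d0 : 0 < cabs D by rewrite cabs_gt0.
have k0 := cabs_ge0 (A 1 0).
apply/nbhs_SomeP.
exists (Num.min (cabs D / (2 * (cabs (A 1 0) + 1))) (e * cabs D ^+ 2 / 2)).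
  by rewrite lt_min !divr_gt0 ?mulr_gt0 ?exprn_gt0// ltr_wpDl.
move=> w; rewrite lt_min ltr_pdivlMr ?mulr_gt0 ?ltr_wpDl// => /andP[wz1 wz2].
have Dw : cabs D / 2 <= cabs (A 1 0 * w + A 1 1).
  have := cabs_distD D (A 1 0 * w + A 1 1).
  rewrite [D - _](_ : _ = A 1 0 * (z - w)); last by rewrite /D; ring.
  rewrite cabsM cabsC; have := cabs_ge0 (w - z); nra.
have Dw0 : A 1 0 * w + A 1 1 != 0.
  by rewrite -cabs_gt0; apply: lt_le_trans Dw; lra.
rewrite /= (negbTE Dw0); apply: eV.
rewrite mobius_sub// cabsM cabsV cabsM ltr_pdivrMr; last first.
  by rewrite mulr_gt0// cabs_gt0.
apply: lt_le_trans wz2 _; rewrite -/D.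
by have := ler_wpM2l (ltW (mulr_gt0 e0 d0)) Dw; nra.
Qed.

Lemma mobius_continuous_pole A z : \det A = 1 -> A 1 0 * z + A 1 1 = 0 ->
  {for (Some z : sphere), continuous (mobius A)}.
Proof.
move=> dA Dz V; rewrite /= Dz eqxx => /nbhs_NoneP[VN [M MV]].
change (nbhs (Some z : sphere) (mobius A @^-1` V)).
have c0 : A 1 0 != 0.
  apply/eqP => c0; move: Dz (oner_eq0 R[i]); rewrite c0 mul0r add0r => d0.
  by rewrite -dA det2 c0 d0 !mulr0 subrr eqxx.
have k0 : 0 < cabs (A 1 0) by rewrite cabs_gt0.
set K := `|M| + cabs (A 0 0 / A 1 0) + 1.
have K0 : 0 < K by rewrite ltr_wpDl// addr_ge0// cabs_ge0.
apply/nbhs_SomeP; exists (cabs (A 1 0) ^+ 2 * K)^-1.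
  by rewrite invr_gt0 mulr_gt0// exprn_gt0.
move=> w wz; rewrite /=; case: ifPn => // Dw; apply: MV.
have := cabs_distD (A 0 0 / A 1 0) ((A 0 0 * w + A 0 1) / (A 1 0 * w + A 1 1)).
have := cabs_distD
  (A 0 0 / A 1 0 - (A 0 0 * w + A 0 1) / (A 1 0 * w + A 1 1)) (A 0 0 / A 1 0).
rewrite addrAC subrr add0r cabsN mobius_subNone// cabsV cabsM.
have -> : A 1 0 * w + A 1 1 = A 1 0 * (w - z).
  by rewrite mulrBr -[RHS]addr0 -Dz; ring.
rewrite cabsM => h _.
have wz0 : 0 < cabs (w - z).
  by rewrite cabs_gt0 subr_eq0; apply: contra Dw => /eqP->; rewrite Dz.
have : K < (cabs (A 1 0) * (cabs (A 1 0) * cabs (w - z)))^-1.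
  rewrite -[K]invrK ltf_pV2 ?posrE ?invr_gt0 ?mulr_gt0//.
  rewrite -[K^-1]mul1r ltr_pdivlMr//; move: wz.
  by rewrite -[X in _ < X]mul1r ltr_pdivlMr ?mulr_gt0 ?exprn_gt0//; lra.
have := ler_norm M; rewrite /K; move: h; lra.
Qed.

Lemma mobius_continuous_None A : \det A = 1 ->
  {for (None : sphere), continuous (mobius A)}.
Proof.
move=> dA V; change (nbhs (mobius A (None : sphere)) V ->
  nbhs (None : sphere) (mobius A @^-1` V)); rewrite /=.
have [c0|c0] := eqVneq (A 1 0) 0.
  move=> /nbhs_NoneP[VN [M MV]]; apply/nbhs_NoneP; split.
    by rewrite /= c0 eqxx.
  have ad : A 0 0 * A 1 1 = 1 by rewrite -dA det2 c0 mulr0 subr0.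
  have d0 : A 1 1 != 0.
    by apply/eqP => d0; have := oner_eq0 R[i]; rewrite -ad d0 mulr0 eqxx.
  have a0 : A 0 0 != 0.
    by apply/eqP => a0; have := oner_eq0 R[i]; rewrite -ad a0 mul0r eqxx.
  exists ((`|M| * cabs (A 1 1) + cabs (A 0 1)) / cabs (A 0 0)) => w.
  rewrite ltr_pdivrMr ?cabs_gt0// => wM.
  rewrite /= c0 mul0r add0r (negbTE d0); apply: MV.
  rewrite cabsM cabsV ltr_pdivlMr ?cabs_gt0//.
  have := cabsD (A 0 0 * w + A 0 1) (- A 0 1); rewrite addrK cabsN cabsM.
  have := ler_norm M; have := cabs_ge0 (A 1 1); nra.
move=> /nbhs_SomeP[e e0 eV]; apply/nbhs_NoneP; split.
  by rewrite /= (negbTE c0); apply: eV; rewrite subrr cabs0.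
have k0 : 0 < cabs (A 1 0) by rewrite cabs_gt0.
have ke0 : 0 < (cabs (A 1 0) * e)^-1 by rewrite invr_gt0 mulr_gt0.
exists ((cabs (A 1 1) + (cabs (A 1 0) * e)^-1) / cabs (A 1 0)) => w.
rewrite ltr_pdivrMr// => wM.
have Dw : (cabs (A 1 0) * e)^-1 < cabs (A 1 0 * w + A 1 1).
  have := cabsD (A 1 0 * w + A 1 1) (- A 1 1); rewrite addrK cabsN cabsM; nra.
have Dw0 : A 1 0 * w + A 1 1 != 0 by rewrite -cabs_gt0; exact: lt_trans Dw.
rewrite /= (negbTE Dw0); apply: eV; rewrite cabsC mobius_subNone// cabsV cabsM.
rewrite -[e]invrK ltf_pV2 ?posrE ?mulr_gt0 ?invr_gt0 ?cabs_gt0//.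
by move: Dw; rewrite invfM -ltr_pdivrMl ?invr_gt0// invrK mulrC.
Qed.

Lemma mobius_continuous A : \det A = 1 -> continuous (mobius A).
Proof.
move=> dA [z|]; last exact: mobius_continuous_None.
have [Dz|Dz] := eqVneq (A 1 0 * z + A 1 1) 0.
  exact: mobius_continuous_pole.
exact: mobius_continuous_fin.
Qed.

Lemma mobius_to_None p : exists2 N : mat, \det N = 1 & mobius N p = None.
Proof.
case: p => [z|]; last first.
  by exists 1%:M; [exact: det1|rewrite mobius1].
exists (\matrix_(i, j) if i == 0 then (if j == 0 then 0 else -1)
                       else (if j == 0 then 1 else - z)).
  by rewrite det2 !mxE /= mul0r sub0r mulr1 opprK.
by rewrite /mobius !mxE /= mul1r subrr eqxx.
Qed.

Lemma star_connected (A : set C) z : A z ->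
  (forall w (t : R), A w -> 0 <= t <= 1 -> A (z + t%:C%C * (w - z))) ->
  connected (Some @` A : set sphere).
Proof.
move=> Az Astar.
pose g w (t : R) : sphere := Some (z + t%:C%C * (w - z) : C).
have gc w : continuous (g w).
  move=> t V /nbhs_SomeP[e e0 eV].
  change (nbhs t (g w @^-1` V)); apply/nbhs_ballP.
  exists (e / (cabs (w - z) + 1)) => /=.
    by rewrite divr_gt0// ltr_wpDl// cabs_ge0.
  move=> u; rewrite /ball /= ltr_pdivlMr ?ltr_wpDl ?cabs_ge0// => tu; apply: eV.
  have -> : (z + u%:C%C * (w - z)) - (z + t%:C%C * (w - z)) =
    (u - t)%:C%C * (w - z) :> C by rewrite rmorphB /=; ring.
  rewrite cabsM cabs_real distrC; have := normr_ge0 (t - u); nra.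
have -> : Some @` A = \bigcup_(w in A) (g w @` `[0, 1]%classic).
  apply/seteqP; split=> [_ [w Aw <-]|_ [w Aw [t /= t01 <-]]].
    exists w => //; exists 1; first by rewrite /= in_itv /= lexx ler01.
    by rewrite /g rmorph1 mul1r addrC subrK.
  exists (z + t%:C%C * (w - z)) => //; apply: Astar => //.
apply: bigcup_connected.
  exists (Some z) => w Aw; exists 0; first by rewrite /= in_itv /= lexx ler01.
  by rewrite /g rmorph0 mul0r addr0.
move=> w Aw; apply: connected_continuous_connected.
  exact: segment_connected.
exact/continuous_subspaceT/gc.
Qed.

(** The plane is connected and dense. *)
Lemma sphere_connected : connected [set: sphere].
Proof.
have : connected (closure (Some @` [set: C] : set sphere)).
  by apply: connected_closure; exact: (@star_connected _ 0).
congr connected; apply/seteqP; split=> // -[w|] _.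
  by apply: subset_closure; exists w.
move=> V /nbhs_NoneP[_ [M MV]]; exists (Some ((`|M| + 1)%:C%C : C)); split.
  by eexists.
apply: MV; rewrite cabs_real ger0_norm ?addr_ge0//.
by have := ler_norm M; lra.
Qed.

(** Finite points have discs as neighbourhoods; a Moebius transformation reduces
    the point at infinity to a finite one. *)
Lemma sphere_locally_connected p (V : set sphere) : nbhs p V ->
  exists W, [/\ nbhs p W, connected W & W `<=` V].
Proof.
have fin z (U : set sphere) : nbhs (Some z : sphere) U ->
    exists W, [/\ nbhs (Some z : sphere) W, connected W & W `<=` U].
  move=> /nbhs_SomeP[e e0 eU]; exists (Some @` [set w : C | cabs (w - z) < e]).
  split; last by move=> _ [w /= wz <-]; exact: eU.
    by apply/nbhs_SomeP; exists e => // w wz; exists w.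
  apply: (@star_connected _ z) => [|w t /= wz /andP[t0 t1]] /=.
    by rewrite subrr cabs0.
  rewrite addrAC subrr add0r cabsM cabs_real ger0_norm//.
  have := cabs_ge0 (w - z); nra.
case: p => [z|]; first exact: fin.
have [N dN N0] := mobius_to_None (Some (0 : C)).
have cN := mobius_continuous dN.
have cN' := mobius_continuous (det_adj dN).
have N'0 : mobius (\adj N) None = Some (0 : C) by rewrite -N0 mobius_adjK.
move=> VN; have [|W [W0 cW WV]] := fin 0 (mobius N @^-1` V).
  by apply: (cN (Some (0 : C)) V); rewrite N0.
exists (mobius N @` W); split; last by move=> _ [w /WV ? <-].
  have : nbhs (None : sphere) (mobius (\adj N) @^-1` W).
    by apply: (cN' (None : sphere) W); rewrite N'0.
  apply: filterS => q /= Wq; exists (mobius (\adj N) q) => //.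
  by rewrite mobius_Kadj.
by apply: connected_continuous_connected => //; exact: continuous_subspaceT.
Qed.

Lemma component_open (A : set sphere) p : open A ->
  open (connected_component A p).
Proof.
move=> oA; rewrite openE => q Cq.
have Aq : A q by exact: connected_component_sub Cq.
have [W [Wq cW WA]] := sphere_locally_connected (open_nbhs_nbhs (conj oA Aq)).
apply: filterS (Wq) => x Wx; rewrite (same_connected_component Cq).
by exists W => //; split=> //; exact: (nbhs_singleton Wq).
Qed.

End sphere_topology.

(** * Cylinders of Moebius ping-pong systems shrink to points *)

Section separation.
Variable R : realType.
Local Notation C := (R[i]^o).
Local Notation sphere := (riemann_sphere R).
Implicit Types (z w : C) (K V : set sphere).

(** Compactness of [K] makes the radius uniform. *)
Lemma closed_separated K V : closed K -> ~ K None -> open V -> K `<=` V ->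
  \forall d \near (0 : R)^'+, forall z w, K (Some z) -> cabs (w - z) < d ->
    V (Some w).
Proof.
move=> cK KN oV KV.
have cptK : compact K by by apply: (subclosed_compact cK (@sphere_compact R)).
have /compact_near_coveringP := cptK.
move=> /(_ R (0 : R)^'+
  (fun d p => forall z w, p = Some z -> cabs (w - z) < d -> V (Some w)) _) cov.
have {}cov : \forall d \near (0:R)^'+, K `<=` (fun p => forall z w,
    p = Some z -> cabs (w - z) < d -> V (Some w)).
  apply: cov => -[z0|//] Kz0.
  have /nbhs_SomeP[r r0 rV] := open_nbhs_nbhs (conj oV (KV _ Kz0)).
  exists ([set p : sphere | forall z, p = Some z -> cabs (z - z0) < r / 2],
    [set d : R | d < r / 2]) => /=.
    split.
      by apply/nbhs_SomeP; exists (r / 2); [rewrite divr_gt0|move=> w ? _ [<-]].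
    by apply: nbhs_right_lt; rewrite divr_gt0.
  move=> [p d] /= [pz dr] z w pE wz; apply: rV.
  have := pz _ pE; have := cabs_dist w z0 z; move: wz dr; lra.
by apply: filterS cov => d Kd z w Kz; exact: Kd Kz _ _ erefl.
Qed.

Lemma closed_bounded (I : finType) (B : I -> set sphere) :
  (forall i, closed (B i)) -> (forall i, ~ B i None) ->
  exists2 M : R, 0 < M & forall i z, B i (Some z) -> cabs z <= M.
Proof.
move=> cB BN; have : \forall p \near (None : sphere), forall i, ~ B i p.
  apply: (@filter_forall _ _ (fun i => ~` B i) _
    (nbhs_filter (None : sphere))) => i.
  apply: (@open_nbhs_nbhs _ _ (~` B i)); split; last exact: BN.
  exact: closed_openC.
move=> /nbhs_NoneP[_ [M MB]]; exists (`|M| + 1); first by rewrite ltr_wpDl.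
move=> i z; apply: contraPP => /negP; rewrite -ltNge => zM; apply: (MB z).
by apply: lt_trans zM; have := ler_norm M; lra.
Qed.

(** A bounded sequence accumulates, by compactness of the disc. *)
Lemma no_separated_sequence (q : nat -> C) (M s : R) : 0 < s ->
  (forall n, cabs (q n) <= M) ->
  ~ (forall m n, (n < m)%N -> s <= cabs (q m - q n)).
Proof.
move=> s0 qM sep.
have [p [_ pq]] : [set z : C | cabs z <= M] `&` cluster (q @ \oo) !=set0.
  by apply: (@compact_disc R M (q @ \oo)); exists 0%N => // n _; exact: qM.
have pV : nbhs p [set z : C | cabs (z - p) < s / 2].
  by apply/nbhs_planeP; exists (s / 2) => //; exact: divr_gt0.
have q0 : (q @ \oo) (range q) by exists 0%N => // n _; exists n.
have [_ [[n _ <-] /= qn]] := pq _ _ q0 pV.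
have qS : (q @ \oo) (q @` [set m | (n < m)%N]).
  by exists n.+1 => // m nm; exists m.
have [_ [[m /= nm <-] /= qm]] := pq _ _ qS pV.
have := sep _ _ nm; have := cabs_dist (q m) (q n) p.
rewrite (cabsC p); move: qn qm; lra.
Qed.

End separation.

Section shrinking.
Variables (R : realType) (I : finType) (inv : I -> I).
Hypothesis invK : involutive inv.
Local Notation C := (R[i]^o).
Local Notation sphere := (riemann_sphere R).
Variables (A : I -> 'M[R[i]^o]_2) (B : I -> set sphere).
Let e i := mobius (A i).
Hypothesis dA : forall i, \det (A i) = 1.
Hypothesis eB : ping_pong inv e B.
Hypothesis BN : forall i, ~ B i None.
Local Notation petal := (petal inv e B).
Local Notation cylinder := (cylinder inv e B).

Fixpoint word_mx w := if w is i :: w' then word_mx w' *m A i else 1%:M.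

Lemma det_word_mx w : \det (word_mx w) = 1.
Proof.
by elim: w => [|i w IHw] /=; rewrite ?det1// det_mulmx IHw dA mul1r.
Qed.

Lemma alongE w : along e w = mobius (word_mx w).
Proof.
elim: w => [|i w IHw] /=; first by rewrite mobius1.
by apply/funext => p; rewrite IHw mobiusM// dA oner_eq0.
Qed.

Lemma next_letter i j x : petal i x -> petal j (e i x) -> j <> inv i.
Proof. by move=> Ui /(pp_petal eB) Bj ji; apply: Ui; rewrite -ji. Qed.

Lemma along_inside i w x : cylinder (i :: w) x ->
  ~ B (inv (last i w)) (along e (i :: w) x).
Proof.
by elim: w i x => [|j w IHw] i x; [case|case=> _; exact: IHw].
Qed.

(** Ping-pong: outside of its petal a letter maps into the side of its inverse,
    which is disjoint from the petal of the next letter. *)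
Lemma along_outside i w x p : cylinder (i :: w) x -> ~ petal i p ->
  B (inv (last i w)) (along e (i :: w) p).
Proof.
elim: w i x p => [|j w IHw] i x p /=; first by move=> _ /contrapT.
move=> [Ui [Uj cw]] /contrapT Bp; apply: (IHw j (e i x)) => // /(pp_petal eB).
by move=> /(pp_disj eB Bp) ij; exact: (next_letter Ui Uj).
Qed.

(** Read the word backwards: its last letter leaves all the closed sets only from
    its petal, and the letter before reaches this petal only from its own petal,
    since elsewhere it leads into another closed set. *)
Lemma along_away w x q : cylinder w x -> (forall i, ~ B i (along e w q)) ->
  cylinder w q.
Proof.
elim: w x q => [//|i w IHw] x q [Ui cw] Bq.
have cq := IHw _ _ cw Bq; split=> //; case: w cw Bq cq {IHw} => [|j w].
  by move=> _ /(_ (inv i)).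
move=> [Uj _] _ [Ujq _] Biq; apply: (next_letter Ui Uj).
by apply: (pp_disj eB _ Biq); exact: (pp_petal eB).
Qed.

Lemma petal_finite i p : petal i p -> exists z, p = Some z.
Proof. by case: p => [z|/(pp_petal eB)/BN//]; exists z. Qed.

Section bounds.
Variables (rho delta : R).
Hypotheses (rho0 : 0 < rho) (delta0 : 0 < delta).
Hypothesis Brho : forall i z, B i (Some z) -> cabs z <= rho.
Hypothesis Bdelta : forall i j z w, i <> j -> B i (Some z) -> B j (Some w) ->
  delta <= cabs (z - w).

Lemma word_mx_lower_neq0 i w x : cylinder (i :: w) x ->
  word_mx (i :: w) 1 0 != 0.
Proof.
move=> cw; have := along_outside cw (p := None).
rewrite alongE; set m := word_mx (i :: w) => Bm.
apply/eqP => m0; have /Bm : ~ petal i None by move=> /(pp_petal eB)/BN.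
by rewrite /= m0 eqxx; exact: BN.
Qed.

(** Write [c] and [D] for the lower left entry and the denominator of the matrix
    [m] of [w]. The images of infinity and of a point [u] of the cylinder lie in
    distinct sides, and their distance is [1 / |c D(u)|]; so [|c D(u)|] is at
    most [1 / delta]. The images of [y] and [z] lie in the same bounded side, and
    their distance is [|y - z| / |D(y) D(z)|]. *)
Lemma cylinder_diam w i y z : w != [::] ->
  cylinder (rcons w i) (Some y) -> cylinder (rcons w i) (Some z) ->
  cabs (y - z) * (cabs (word_mx w 1 0) * delta) ^+ 2 <= 2 * rho.
Proof.
case: w => [//|j w] _ cy cz; set m := word_mx _.
have c0 : m 1 0 != 0 by move: cy => /cylinder_rcons[/word_mx_lower_neq0].
have [cwy Uy] := (cylinder_rcons _ _ _ _ _ _).1 cy.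
have [l lE] : exists l, l = last j w by eexists.
have li : inv l <> i.
  move=> liE; apply: (along_inside cwy); rewrite -lE liE.
  exact: (pp_petal eB).
have [a aE] : exists a, mobius m None = Some a.
  by rewrite /= (negbTE c0); eexists.
have Ba : B (inv l) (Some a).
  rewrite -aE -alongE lE; apply: (along_outside cwy).
  by move=> /(pp_petal eB)/BN.
move: aE; rewrite /= (negbTE c0) => -[aE].
have den u : cylinder (rcons (j :: w) i) (Some u) ->
  [/\ m 1 0 * u + m 1 1 != 0,
   B i (Some ((m 0 0 * u + m 0 1) / (m 1 0 * u + m 1 1))) &
   cabs (m 1 0) * cabs (m 1 0 * u + m 1 1) * delta <= 1].
  move=> /cylinder_rcons[_]; rewrite alongE -/m /= => /(pp_petal eB).
  case: ifPn => [_ /BN//|Du Bu]; split=> //.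
  have := Bdelta li Ba Bu; rewrite -aE mobius_subNone ?det_word_mx//.
  rewrite cabsV cabsM -[X in _ <= X]mul1r ler_pdivlMr ?mulr_gt0 ?cabs_gt0//.
  by rewrite mulrC.
have [Dy By ky] := den _ cy; have [Dz Bz kz] := den _ cz.
have := cabsD ((m 0 0 * y + m 0 1) / (m 1 0 * y + m 1 1))
  (- ((m 0 0 * z + m 0 1) / (m 1 0 * z + m 1 1))).
rewrite cabsN mobius_sub ?det_word_mx// cabsM cabsV cabsM.
have := Brho By; have := Brho Bz; set u := cabs (_ / _); set v := cabs (_ / _).
move=> vr ur; rewrite ler_pdivrMr ?mulr_gt0 ?cabs_gt0// => yz.
set k := cabs (m 1 0) in ky kz *.
set P := k * _ * delta in ky; set Q := k * _ * delta in kz.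
have k0 : 0 <= k := cabs_ge0 _.
have [P0 Q0] : 0 <= P /\ 0 <= Q.
  by split; rewrite !mulr_ge0 ?cabs_ge0// ltW.
have PQ : P * Q <= 1 by rewrite mulr_ile1.
have uv : 0 <= u + v by rewrite addr_ge0 ?cabs_ge0.
apply: (@le_trans _ _ ((u + v) * (P * Q))); last by nra.
apply: (le_trans (ler_wpM2r (sqr_ge0 _) yz)).
by rewrite le_eqVlt; apply/orP; left; apply/eqP; rewrite /P /Q; ring.
Qed.

(** [q] is the pole of [M], and [a - b = 1 / (c^2 (z - q))] has modulus more
    than [2 rho] on the disc of the statement. *)
Lemma pole_disc (M : 'M[R[i]^o]_2) (kappa : R) (z q a b : C) :
  \det M = 1 -> M 1 0 != 0 -> cabs (M 1 0) ^+ 2 <= kappa ->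
  mobius M None = Some a -> cabs a <= rho -> mobius M (Some q) = None ->
  cabs (z - q) < (2 * rho * kappa)^-1 -> mobius M (Some z) = Some b ->
  rho < cabs b.
Proof.
move=> dM c0 ck; rewrite /= (negbTE c0) => -[aE] arho.
case: ifPn => // /eqP Dq _ zq; case: ifPn => // Dz [bE].
have k0 : 0 < cabs (M 1 0) by rewrite cabs_gt0.
have DE : M 1 0 * z + M 1 1 = M 1 0 * (z - q).
  by rewrite mulrBr -[RHS]addr0 -Dq; ring.
have zq0 : 0 < cabs (z - q).
  by rewrite cabs_gt0; apply: contra Dz => /eqP zq0; rewrite DE zq0 mulr0.
have := mobius_subNone dM c0 Dz; rewrite aE bE DE => ab.
have := cabsD a (- b); rewrite cabsN ab cabsV !cabsM.
have : 2 * rho < (cabs (M 1 0) * (cabs (M 1 0) * cabs (z - q)))^-1.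
  rewrite -[X in _ < X]mul1r ltr_pdivlMr ?mulr_gt0//.
  have kappa0 : 0 < kappa by apply: lt_le_trans ck; rewrite exprn_gt0.
  move: zq; rewrite -[X in _ < X]mul1r ltr_pdivlMr ?mulr_gt0// => zq.
  apply: le_lt_trans zq.
  have := ler_wpM2l (ltW (mulr_gt0 rho0 zq0)) ck; nra.
move: arho; lra.
Qed.

(** If the lower left entries [c] stayed bounded along the itinerary of a limit
    point, the discs of radius [1 / (2 rho c^2)] about the poles would have
    radii bounded below. Such a disc is mapped outside of all the closed sets,
    and this forces the poles of the later words to stay out of it, so that
    the poles would be a separated sequence in a bounded region. *)
Lemma word_mx_unbounded y (W : nat -> seq I) (kappa : R) : 0 < kappa ->
  (forall n, size (W n) = n /\ cylinder (W n) y) ->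
  ~ (forall n, cabs (word_mx (W n.+1) 1 0) ^+ 2 <= kappa).
Proof.
move=> kappa0 WP Wk.
have Wpre m n : (m <= n)%N -> prefix (W m) (W n).
  move=> mn; have [Wm cm] := WP m; have [Wn cn] := WP n.
  by apply: (itinerary_prefix eB cm cn); rewrite Wm Wn.
have Wc n : exists i w, W n.+1 = i :: w.
  by have [] := WP n.+1; case: (W n.+1) => // i w _ _; exists i, w.
have c0 n : word_mx (W n.+1) 1 0 != 0.
  have [_] := WP n.+1; have [i [w ->]] := Wc n; exact: word_mx_lower_neq0.
pose q n : C := - (word_mx (W n.+1) 1 1 / word_mx (W n.+1) 1 0).
have qN n : along e (W n.+1) (Some (q n)) = None.
  by rewrite alongE /= /q mulrN mulrC divfK ?c0// addNr eqxx.
have qc n : cylinder (W n.+1) (Some (q n)).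
  have [_ cn] := WP n.+1; apply: (along_away cn) => i; rewrite qN; exact: BN.
have qrho n : cabs (q n) <= rho.
  have := qc n; have [i [w ->]] := Wc n.
  by case=> /(pp_petal eB) /Brho.
have s0 : 0 < (2 * rho * kappa)^-1 by rewrite invr_gt0 !mulr_gt0.
apply: (no_separated_sequence s0 qrho) => m n nm.
rewrite leNgt; apply/negP => qmn.
have [i cWi] : exists i, cylinder (rcons (W n.+1) i) (Some (q m)).
  have [_ cm] := WP m.+1; have [Wm _] := WP m.+1; have [Wn _] := WP n.+1.
  have /prefixP[[|i v] Wv] := Wpre n.+1 m.+1 (ltnW nm).
    by move: nm; rewrite -ltnS -Wm -Wn Wv cats0 ltnn.
  exists i; apply: cylinder_prefix (qc m).
  by rewrite Wv -cat_rcons prefix_prefix.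
have [_ /(pp_petal eB)] := (cylinder_rcons _ _ _ _ _ _).1 cWi.
have [a aN arho] : exists2 a, mobius (word_mx (W n.+1)) None = Some a &
    cabs a <= rho.
  have [i' [w W']] := Wc n; have [_ cn] := WP n.+1; rewrite W' in cn *.
  have := along_outside cn (p := None).
  rewrite alongE; set p := mobius _ _ => Bp.
  have /Bp : ~ petal i' None by move=> /(pp_petal eB)/BN.
  by case: p {Bp} => [a /Brho|/BN//]; exists a.
have := qN n; rewrite !alongE => qNn.
case bE : (mobius (word_mx (W n.+1)) (Some (q m))) => [b|]; last exact: BN.
move=> /Brho; apply/negP; rewrite -ltNge.
exact: (pole_disc (det_word_mx _) (c0 n) (Wk n) aN arho qNn qmn bE).
Qed.

End bounds.

(** The diameter of a cylinder is at most of order [1 / |c|^2], where [c] is the lower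
    left entry of the matrix of the word, and [c] is unbounded. *)
Lemma mobius_shrinking : shrinking inv e B.
Proof.
have [M M0 BM] := closed_bounded (@pp_closed _ _ _ _ _ eB) BN.
have [d d0 Bd] : exists2 d : R, 0 < d & forall i j z w, i <> j ->
    B i (Some z) -> B j (Some w) -> d <= cabs (z - w).
  have : \forall d \near (0 : R)^'+, forall ij : I * I, ij.1 <> ij.2 ->
    forall z w, B ij.1 (Some z) -> cabs (w - z) < d -> (~` B ij.2) (Some w).
    apply: filter_forall => -[i j] /=.
    have [<-|/eqP ij] := eqVneq i j; first exact: nearW.
    have := @closed_separated R (B i) (~` B j) (pp_closed eB (i := i)) (@BN i).
    move=> /(_ (closed_openC (pp_closed eB (i := j)))) cov.
    have {cov} : \forall d \near (0 : R)^'+, forall z w, B i (Some z) ->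
        cabs (w - z) < d -> (~` B j) (Some w).
      by apply: cov => p Bi /(pp_disj eB Bi).
    by apply: filterS => d dP _.
  move=> sep; have [d [d0 dP]] := filter_ex (filterI (nbhs_right_gt 0) sep).
  exists d => // i j z w ij Bz Bw; rewrite leNgt cabsC; apply/negP => zw.
  exact: (dP (i, j) ij z w Bz zw).
move=> y ly V Vy; apply: contrapT => nV.
have /choice[W WP] n : exists w, size w = n /\ cylinder w y.
  by have [w wn cw] := ly n; exists w.
have [y0 yE] : exists y0, y = Some y0.
  have [] := WP 1%N; case: (W 1%N) => [//|i w] _ [Uy _]; exact: petal_finite Uy.
rewrite yE in Vy WP nV; have [r r0 rV] := (nbhs_SomeP _ _).1 Vy.
(* If no cylinder of [y] is contained in [V], their diameters stay above [r], and
   this bounds the lower left entries. *)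
have kappa0 : 0 < 2 * M / (r * d ^+ 2).
  by rewrite divr_gt0 ?mulr_gt0// exprn_gt0.
apply: (word_mx_unbounded M0 BM kappa0 WP) => n.
have [Wn2 cn2] := WP n.+2; have [Wn1 cn1] := WP n.+1.
have [i Wi] : exists i, W n.+2 = rcons (W n.+1) i.
  have /prefixP[v Wv] : prefix (W n.+1) (W n.+2).
    by apply: (itinerary_prefix eB cn1 cn2); rewrite Wn1 Wn2.
  move: (congr1 size Wv); rewrite size_cat Wn1 Wn2 -[n.+2]addn1 => /addnI.
  by case: v Wv => [|i [|j v]] // Wv _; exists i; rewrite addn1 Wv cats1.
rewrite Wi in cn2.
have [z cz nVz] : exists2 z, cylinder (rcons (W n.+1) i) z & ~ V z.
  have : ~ (cylinder (rcons (W n.+1) i) `<=` V).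
    by move=> sub; apply: nV; exists (rcons (W n.+1) i).
  by move=> /existsNP[z /not_implyP[cz nVz]]; exists z.
have W0 : W n.+1 != [::] by rewrite -size_eq0 Wn1.
have [z0 zE] : exists z0, z = Some z0.
  by case: (W n.+1) W0 cz => [//|j w] _ [Uz _]; exact: petal_finite Uz.
rewrite zE in cz nVz.
have := cylinder_diam d0 BM Bd W0 cn2 cz.
have : r <= cabs (y0 - z0).
  by rewrite cabsC leNgt; apply/negP => /rV.
rewrite ler_pdivlMr ?mulr_gt0 ?exprn_gt0// exprMn.
have : 0 <= cabs (word_mx (W n.+1) 1 0) ^+ 2 * d ^+ 2.
  by rewrite mulr_ge0 ?sqr_ge0.
move=> X0 rm; have := ler_wpM2r X0 rm; lra.
Qed.

End shrinking.

(** * A homeomorphism realising small perturbations of the generators *)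

Section plane_maps.
Variable R : realType.
Local Notation C := (R[i]^o).
Local Notation sphere := (riemann_sphere R).
Local Notation mat := ('M[R[i]^o]_2).
Implicit Types (z w : C).

Lemma cabs_sum (J : finType) (F : J -> C) :
  cabs (\sum_j F j) <= \sum_j cabs (F j).
Proof.
elim/big_ind2: _ => [|a b c d ab cd|//]; first by rewrite cabs0.
exact: le_trans (cabsD _ _) (lerD ab cd).
Qed.

Definition extend_sphere (g : C -> C) (p : sphere) : sphere :=
  if p is Some z then Some (g z) else None.

Lemma extend_sphere_continuous (g : C -> C) (L : R) : 0 < L ->
  (forall z w, cabs (g z - g w) <= L * cabs (z - w)) ->
  (forall z, cabs (g z - z) <= 1) -> continuous (extend_sphere g).
Proof.
move=> L0 gL g1 [z|] V.
  move=> /nbhs_SomeP[e e0 eV].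
  change (nbhs (Some z : sphere) (extend_sphere g @^-1` V)).
  apply/nbhs_SomeP; exists (e / L); first exact: divr_gt0.
  move=> w; rewrite ltr_pdivlMr// => wz; apply: eV.
  by apply: le_lt_trans (gL _ _) _; rewrite mulrC.
move=> /nbhs_NoneP[VN [M MV]].
change (nbhs (None : sphere) (extend_sphere g @^-1` V)).
apply/nbhs_NoneP; split=> //; exists (M + 1) => w wM; apply: MV.
have := g1 w; have := cabs_dist w 0 (g w); rewrite !subr0 (cabsC w).
move: wM; lra.
Qed.

(** Let [z0] minimise the distance of [z + u z] to [y]. The point [y - u z0] at
    least halves this distance, which is therefore [0]. *)
Lemma near_id_surjective (u : C -> C) :
  (forall z w, cabs (u z - u w) <= 2^-1 * cabs (z - w)) ->
  (forall z, cabs (u z) <= 1) -> forall y, exists z, z + u z = y.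
Proof.
move=> uL u1 y; pose f (z : C) : R := cabs (z + u z - y).
have fL z w : f w <= f z + 2 * cabs (w - z).
  have := cabs_distD (w + u w - y) (z + u z - y).
  have -> : w + u w - y - (z + u z - y) = (w - z) + (u w - u z) by ring.
  have := cabsD (w - z) (u w - u z); have := uL w z; rewrite -/(f w) -/(f z).
  have := cabs_ge0 (w - z); lra.
have fc : continuous f.
  move=> z V /nbhs_ballP[e /= e0 eV].
  change (nbhs z (f @^-1` V)); apply/nbhs_planeP.
  exists (e / 2); first exact: divr_gt0.
  move=> w wz; apply: eV; rewrite /ball /= ltr_norml.
  have := fL z w; have := fL w z; rewrite (cabsC z); move: wz; lra.
have [|z0] := compact_EVT_min _ (@compact_disc R (cabs y + 1))
    (continuous_subspaceT fc).
  exists (0 : C); suff : cabs (0 : C) <= cabs y + 1 by [].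
  by rewrite cabs0 addr_ge0 ?cabs_ge0.
move=> _ /(_ (y - u z0)); rewrite inE /= => min.
have {}min : f z0 <= f (y - u z0).
  by apply: min; apply: le_trans (cabsD _ _) _; rewrite cabsN lerD2l.
exists z0; apply/eqP; rewrite -subr_eq0 -cabs_eq0 -/(f z0).
have f0 : 0 <= f z0 := cabs_ge0 _.
have := uL (y - u z0) z0.
have -> : u (y - u z0) - u z0 = y - u z0 + u (y - u z0) - y by ring.
have -> : cabs (y - u z0 - z0) = f z0.
  by rewrite /f -cabsN; congr cabs; ring.
rewrite -/(f (y - u z0)) => h; apply/eqP; lra.
Qed.

Lemma near_id_homeo (u : C -> C) :
  (forall z w, cabs (u z - u w) <= 2^-1 * cabs (z - w)) ->
  (forall z, cabs (u z) <= 1) ->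
  exists k0 : sphere -> sphere,
    [/\ cancel (extend_sphere (fun z => z + u z)) k0,
        cancel k0 (extend_sphere (fun z => z + u z)),
        continuous (extend_sphere (fun z => z + u z)) & continuous k0].
Proof.
move=> uL u1; have /choice[k kP] := near_id_surjective uL u1.
have lower z w : cabs (z - w) <= 2 * cabs (z + u z - (w + u w)).
  have := cabsD (z + u z - (w + u w)) (- (u z - u w)).
  have -> : z + u z - (w + u w) - (u z - u w) = z - w by ring.
  rewrite cabsN; have := uL z w; lra.
have kK z : k (z + u z) = z.
  apply/eqP; rewrite -subr_eq0 -cabs_eq0 eq_le cabs_ge0 andbT.
  by apply: le_trans (lower _ _) _; rewrite kP subrr cabs0 mulr0.
exists (extend_sphere k); split.
- by move=> [z|] //=; rewrite kK.
- by move=> [z|] //=; rewrite kP.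
- apply: (@extend_sphere_continuous _ 2) => [//|z w|z]; last first.
    by rewrite addrAC subrr add0r.
  have := cabsD (z - w) (u z - u w).
  have -> : z - w + (u z - u w) = z + u z - (w + u w) by ring.
  have := cabs_ge0 (z - w); have := uL z w; lra.
- apply: (@extend_sphere_continuous _ 2) => [//|z w|z].
    by apply: le_trans (lower _ _) _; rewrite !kP.
  by rewrite -[in X in _ - X](kP z) cabsC addrAC subrr add0r.
Qed.

(** The supremum of the tents [1 - |z - b| / r] of centres [b] in [K]. *)
Lemma lipschitz_cutoff (K : set C) (r : R) : 0 < r ->
  exists phi : C -> R,
    [/\ forall z, 0 <= phi z <= 1,
        forall z w, `|phi z - phi w| <= cabs (z - w) / r,
        forall z, K z -> phi z = 1 &
        forall z, phi z != 0 -> exists2 b, K b & cabs (z - b) < r].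
Proof.
move=> r0.
pose S z := [set t : R | t = 0 \/ exists2 b, K b & t = 1 - cabs (z - b) / r].
have S1 z t : S z t -> t <= 1.
  move=> [->|[b _ ->]]; first exact: ler01.
  by rewrite gerBl divr_ge0 ?cabs_ge0// ltW.
have Sub z : has_ubound (S z) by exists 1 => t; exact: S1.
have S0 z : S z 0 by left.
have Sne z : S z !=set0 by exists 0.
have phi01 z : 0 <= sup (S z) <= 1.
  apply/andP; split; first exact: ub_le_sup.
  by apply: ge_sup => // t; exact: S1.
have lip z w : sup (S z) <= sup (S w) + cabs (z - w) / r.
  apply: ge_sup => // t [->|[b Kb ->]].
    apply: addr_ge0; first by have /andP[] := phi01 w.
    exact: divr_ge0 (cabs_ge0 _) (ltW r0).
  have : 1 - cabs (w - b) / r <= sup (S w).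
    by apply: ub_le_sup => //; right; exists b.
  have : cabs (w - b) / r <= cabs (z - w) / r + cabs (z - b) / r.
    rewrite -mulrDl ler_pM2r ?invr_gt0//.
    by have := cabs_dist w b z; rewrite (cabsC w z).
  lra.
exists (fun z => sup (S z)); split=> //.
- move=> z w; rewrite ler_norml; have := lip z w; have := lip w z.
  by rewrite (cabsC w) => h1 h2; apply/andP; split; lra.
- move=> z Kz; apply/eqP; rewrite eq_le; have /andP[_ ->] /= := phi01 z.
  apply: ub_le_sup => //; right; exists z => //.
  by rewrite subrr cabs0 mul0r subr0.
- move=> z; apply: contraNP => nb; rewrite eq_le; have /andP[-> _] := phi01 z.
  rewrite andbT; apply: ge_sup => // t [->//|[b Kb ->]].
  rewrite subr_le0 ler_pdivlMr// mul1r leNgt; apply/negP => zb.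
  by apply: nb; exists b.
Qed.

End plane_maps.

Section perturbation.
Variable R : realType.
Local Notation C := (R[i]^o).
Local Notation sphere := (riemann_sphere R).
Local Notation mat := ('M[R[i]^o]_2).
Implicit Types (z w : C) (M : mat).

Definition entry_close (e : R) (M N : mat) :=
  forall i j, cabs (M i j - N i j) < e.

Definition mobius_num M z : C := M 0 0 * z + M 0 1.
Definition mobius_den M z : C := M 1 0 * z + M 1 1.

(** With [D] the denominator of [M], the displacement is
    [(M01 + ((M00 - 1) - (M11 - 1)) z - M10 z^2) / D(z)], and [z - w] is multiplied
    by [1 / (D(z) D(w)) - 1] in its increments. *)
Lemma mobius_near_id (rho eta : R) : 0 < rho -> 0 < eta ->
  exists2 e : R, 0 < e & forall M, \det M = 1 -> entry_close e M 1%:M ->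
    let v z := mobius_num M z / mobius_den M z - z in
    (forall z, cabs z <= rho -> mobius_den M z != 0 /\ cabs (v z) <= eta) /\
    (forall z w, cabs z <= rho -> cabs w <= rho ->
      cabs (v z - v w) <= eta * cabs (z - w)).
Proof.
move=> rho0 eta0; set Q := rho + 1.
have Q1 : 1 < Q by rewrite ltrDr.
(* With [e = s / Q^2] the denominator is within [s <= 1/2] of [1]; then [2 s] and
   [10 s] bound the displacement and its Lipschitz constant. *)
set s := Num.min 2^-1 (eta / 10).
have s0 : 0 < s by rewrite lt_min invr_gt0 ltr0n divr_gt0.
have [s2 s10] : s <= 2^-1 /\ s <= eta / 10 by split; rewrite ge_min lexx ?orbT.
have Q20 : 0 < Q ^+ 2 by rewrite exprn_gt0// (lt_trans ltr01).
exists (s / Q ^+ 2); first exact: divr_gt0.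
set e := s / Q ^+ 2.
have e0 : 0 < e by exact: divr_gt0.
have eQ2 : e * Q ^+ 2 = s by rewrite /e divfK// gt_eqF.
have eQ : e * Q <= s by rewrite -eQ2; nra.
move=> M dM Me v.
have := Me 0 0; have := Me 0 1; have := Me 1 0; have := Me 1 1.
rewrite !mxE /= !subr0 => /ltW m11 /ltW m10 /ltW m01 /ltW m00.
have den z : cabs z <= rho -> cabs (mobius_den M z - 1) <= e * Q.
  move=> zr; have -> : mobius_den M z - 1 = M 1 0 * z + (M 1 1 - 1).
    by rewrite /mobius_den addrA.
  apply: le_trans (cabsD _ _) _; rewrite cabsM.
  have := ler_pM (cabs_ge0 _) (cabs_ge0 _) m10 zr; rewrite /Q; lra.
have den2 z : cabs z <= rho -> 2^-1 <= cabs (mobius_den M z).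
  move=> /den; have := cabs_dist 1 0 (mobius_den M z).
  rewrite !subr0 cabs1 (cabsC 1); lra.
have den0 z : cabs z <= rho -> mobius_den M z != 0.
  by move=> /den2 h; rewrite -cabs_gt0; apply: lt_le_trans h; rewrite invr_gt0.
split=> [z zr|z w zr wr].
  split; first exact: den0.
  have -> : v z = (M 0 1 + ((M 0 0 - 1) - (M 1 1 - 1)) * z - M 1 0 * z * z)
      / mobius_den M z.
    rewrite /v /mobius_num; move: (den0 _ zr); rewrite /mobius_den => D0.
    by field.
  rewrite cabsM cabsV ler_pdivrMr ?cabs_gt0 ?den0//.
  have h1 := cabsD (M 0 1 + ((M 0 0 - 1) - (M 1 1 - 1)) * z) (- (M 1 0 * z * z)).
  have h2 := cabsD (M 0 1) (((M 0 0 - 1) - (M 1 1 - 1)) * z).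
  have h3 := cabsD (M 0 0 - 1) (- (M 1 1 - 1)).
  rewrite !cabsN !cabsM in h1 h2 h3.
  have h4 : cabs (M 0 0 - 1 - (M 1 1 - 1)) * cabs z <= (2 * e) * rho.
    apply: ler_pM; rewrite ?cabs_ge0//; lra.
  have h5 : cabs (M 1 0) * cabs z * cabs z <= e * rho * rho.
    by do 2!(apply: ler_pM; rewrite ?mulr_ge0 ?cabs_ge0//).
  have h6 := den2 _ zr.
  have h7 : e * Q ^+ 2 = e + 2 * e * rho + e * rho * rho by rewrite /Q; ring.
  apply: (@le_trans _ _ s); first by rewrite -eQ2; lra.
  by nra.
have -> : v z - v w = (1 - mobius_den M z * mobius_den M w)
    / (mobius_den M z * mobius_den M w) * (z - w).
  have := mobius_sub dM (den0 _ zr) (den0 _ wr).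
  rewrite -/(mobius_den M z) -/(mobius_den M w).
  rewrite -/(mobius_num M z) -/(mobius_num M w).
  have -> : v z - v w = mobius_num M z / mobius_den M z -
    mobius_num M w / mobius_den M w - (z - w) by rewrite /v; ring.
  by move=> ->; move: (den0 _ zr) (den0 _ wr) => D1 D2; field; rewrite D1 D2.
rewrite cabsM; apply: ler_wpM2r; first exact: cabs_ge0.
rewrite cabsM cabsV cabsM ler_pdivrMr ?mulr_gt0 ?cabs_gt0 ?den0//.
have -> : 1 - mobius_den M z * mobius_den M w =
  - ((mobius_den M z - 1) * (mobius_den M w - 1)
    + (mobius_den M z - 1) + (mobius_den M w - 1)) by ring.
rewrite cabsN.
have h1 := cabsD ((mobius_den M z - 1) * (mobius_den M w - 1)
    + (mobius_den M z - 1)) (mobius_den M w - 1).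
have h2 := cabsD ((mobius_den M z - 1) * (mobius_den M w - 1))
  (mobius_den M z - 1).
rewrite cabsM in h2.
have h3 : cabs (mobius_den M z - 1) * cabs (mobius_den M w - 1) <= s * 2^-1.
  have := den _ zr; have := den _ wr => h4 h5.
  by apply: ler_pM; rewrite ?cabs_ge0//; lra.
have h4 : 4^-1 <= cabs (mobius_den M z) * cabs (mobius_den M w).
  rewrite (_ : 4^-1 = 2^-1 * 2^-1); last by lra.
  by apply: ler_pM; rewrite ?invr_ge0// den2.
have := den _ zr; have := den _ wr => h5 h6.
by nra.
Qed.

(** The map sought is [z + sum_j phi_j(z) (M_j z - z)], where [phi_j] is a
    Lipschitz cutoff function that is [1] on [K j] and vanishes away from it. *)
Lemma perturbation_homeo (J : finType) (K V : J -> set sphere) :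
  (forall j, closed (K j)) -> (forall j, ~ K j None) ->
  (forall j, open (V j)) -> (forall j, K j `<=` V j) ->
  exists2 e : R, 0 < e & forall M : J -> mat,
    (forall j, \det (M j) = 1) -> (forall j, entry_close e (M j) 1%:M) ->
    exists h0 k0 : sphere -> sphere,
      [/\ cancel h0 k0, cancel k0 h0, continuous h0 & continuous k0] /\
      (forall j p, K j p -> (forall i, V i p -> i = j) ->
        h0 p = mobius (M j) p) /\
      (forall p, (forall j, ~ V j p) -> \forall q \near p, h0 q = q).
Proof.
move=> cK KN oV KV.
have [rho rho0 Krho] := closed_bounded cK KN.
(* The displacement will live in the [r]-neighbourhoods of the [K j]; the radius
   [2 r] keeps them at distance [r] from the complements of the [V j]. *)
have [r [r0 r1] Kr] : exists2 r : R, 0 < r /\ r <= 1 & forall j z w,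
    K j (Some z) -> cabs (w - z) < 2 * r -> V j (Some w).
  have : \forall d \near (0 : R)^'+, forall j z w, K j (Some z) ->
      cabs (w - z) < d -> V j (Some w).
    apply: filter_forall => j.
    exact: (closed_separated (cK j) (KN j) (oV j) (KV j)).
  move=> Vd; have [d [[d0 dV] d1]] :=
    filter_ex (filterI (filterI (nbhs_right_gt 0) Vd) (nbhs_right_le ltr01)).
  exists (d / 2); first by split; lra.
  by move=> j z w Kz; rewrite mulrC divfK//; exact: dV Kz.
(* Each of the [#|J|] displacements gets Lipschitz constant
   [eta * (1 + 1 / r)], so that their sum has constant at most [1 / 2]. *)
pose eta := ((2 * (#|J|%:R + 1)) * (1 + r^-1))^-1.
have J0 : 0 < #|J|%:R + 1 :> R by rewrite ltr_wpDl.
have ri0 : 0 < r^-1 by rewrite invr_gt0.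
have eta0 : 0 < eta by rewrite invr_gt0 !mulr_gt0// addr_gt0.
have [e e0 eP] := mobius_near_id (addr_gt0 rho0 ltr01) eta0.
exists e => // M dM Me.
pose v j z := mobius_num (M j) z / mobius_den (M j) z - z.
have v1 j z : cabs z <= rho + 1 ->
    mobius_den (M j) z != 0 /\ cabs (v j z) <= eta.
  exact: (eP _ (dM j) (Me j)).1.
have vL j z w : cabs z <= rho + 1 -> cabs w <= rho + 1 ->
  cabs (v j z - v j w) <= eta * cabs (z - w) := (eP _ (dM j) (Me j)).2 z w.
have /choice[phi phiP] j := lipschitz_cutoff [set z | K j (Some z)] r0.
have phi01 j z : 0 <= phi j z <= 1 by have [] := phiP j.
have phiL j z w : `|phi j z - phi j w| <= cabs (z - w) / r by have [] := phiP j.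
have phi1 j z : K j (Some z) -> phi j z = 1 by have [_ _ /(_ z)] := phiP j.
have phiV j z w : phi j z != 0 -> cabs (w - z) < r -> V j (Some w).
  have [_ _ _ /[apply] -[b Kb zb]] := phiP j => wz; apply: (Kr j b) => //.
  have := cabs_dist w b z; lra.
have phi0 j z : phi j z != 0 -> V j (Some z) /\ cabs z <= rho + 1.
  move=> pz; split; first by apply: phiV pz _; rewrite subrr cabs0.
  move: pz; have [_ _ _ /[apply] -[b Kb zb]] := phiP j.
  have := Krho _ _ Kb; have := cabs_distD z b; lra.
pose u j z : C := (phi j z)%:C%C * v j z.
have u1 j z : cabs (u j z) <= eta.
  rewrite cabsM cabs_real; have [->|/phi0[_ zr]] := eqVneq (phi j z) 0.
    by rewrite normr0 mul0r ltW.
  have [_ vz] := v1 j z zr; have /andP[p0 p1] := phi01 j z.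
  by rewrite ger0_norm//; have := cabs_ge0 (v j z); nra.
have uL0 j z w : phi j w = 0 -> phi j z != 0 ->
    cabs (u j z - u j w) <= eta / r * cabs (z - w).
  move=> pw /phi0[_ zr]; rewrite /u pw rmorph0 mul0r subr0 cabsM cabs_real.
  have := phiL j z w; rewrite pw subr0 => pz; have [_ vz] := v1 j z zr.
  apply: le_trans (ler_pM (normr_ge0 _) (cabs_ge0 _) pz vz) _.
  by rewrite le_eqVlt; apply/orP; left; apply/eqP; ring.
have uL j z w : cabs (u j z - u j w) <= eta * (1 + r^-1) * cabs (z - w).
  have weak : eta / r * cabs (z - w) <= eta * (1 + r^-1) * cabs (z - w).
    apply: ler_wpM2r; first exact: cabs_ge0.
    by rewrite ler_pM2l// lerDr.
  have [pz|pz] := eqVneq (phi j z) 0; have [pw|pw] := eqVneq (phi j w) 0.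
  - rewrite /u pz pw rmorph0 !mul0r subrr cabs0.
    by rewrite !mulr_ge0 ?cabs_ge0 ?addr_ge0// ltW.
  - by rewrite cabsC; apply: le_trans (uL0 _ _ _ pz pw) _; rewrite cabsC.
  - exact: le_trans (uL0 _ _ _ pw pz) weak.
  - have [_ zr] := phi0 _ _ pz; have [_ wr] := phi0 _ _ pw.
    have -> : u j z - u j w = (phi j z)%:C%C * (v j z - v j w)
        + (phi j z - phi j w)%:C%C * v j w by rewrite /u rmorphB /=; ring.
    apply: le_trans (cabsD _ _) _; rewrite !cabsM !cabs_real.
    have /andP[p0 p1] := phi01 j z; rewrite ger0_norm//.
    have [_ vw] := v1 j w wr.
    have h1 := ler_pM (normr_ge0 _) (cabs_ge0 _) (phiL j z w) vw.
    have h2 := ler_pM p0 (cabs_ge0 _) p1 (vL j z w zr wr).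
    apply: le_trans (lerD h2 h1) _; rewrite le_eqVlt; apply/orP; left.
    by apply/eqP; ring.
pose U z := \sum_j u j z.
have etaE : #|J|%:R * (eta * (1 + r^-1)) <= 2^-1.
  have -> : eta * (1 + r^-1) = (2 * (#|J|%:R + 1))^-1.
    by rewrite /eta invfM divfK// gt_eqF// addr_gt0.
  by rewrite ler_pdivrMr ?mulr_gt0//; lra.
have eta2 : #|J|%:R * eta <= 1.
  apply: le_trans (_ : 2^-1 <= _); last by rewrite invf_le1// ler1n.
  apply: le_trans etaE; rewrite ler_wpM2l// ler_peMr ?(ltW eta0)//.
  by rewrite lerDl ltW.
have sumJ (c : R) : \sum_(j : J) c = #|J|%:R * c.
  by rewrite sumr_const mulr_natl.
have UL z w : cabs (U z - U w) <= 2^-1 * cabs (z - w).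
  rewrite /U -sumrB; apply: le_trans (cabs_sum _) _.
  apply: le_trans (ler_sum _ (fun j _ => uL j z w)) _.
  by rewrite sumJ mulrA; apply: ler_wpM2r etaE; exact: cabs_ge0.
have U1 z : cabs (U z) <= 1.
  apply: le_trans (cabs_sum _) _.
  by apply: le_trans (ler_sum _ (fun j _ => u1 j z)) _; rewrite sumJ.
have [k0 [h0K k0K h0c k0c]] := near_id_homeo UL U1.
exists (extend_sphere (fun z => z + U z)), k0; split=> //; split.
  move=> j [z|/KN//] Kz Vz /=.
  have zr : cabs z <= rho + 1 by have := Krho _ _ Kz; lra.
  have [D0 _] := v1 j z zr; rewrite (negbTE D0); congr Some.
  rewrite /U (bigD1 j)//= big1 ?addr0 => [|i ij].
    by rewrite /u phi1// rmorph1 mul1r /v addrC subrK.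
  have [pi0|/phi0[/Vz iE _]] := eqVneq (phi i z) 0.
    by rewrite /u pi0 rmorph0 mul0r.
  by move: ij; rewrite iE eqxx.
have fixS w : (forall j, phi j w = 0) ->
    extend_sphere (fun z => z + U z) (Some w : sphere) = Some w.
  by move=> pw; rewrite /= /U big1 ?addr0// => j _; rewrite /u pw rmorph0 mul0r.
move=> [z|] nV.
  apply/nbhs_SomeP; exists r => // w wz; apply: fixS => j.
  apply/eqP; apply: contrapT => /negP pw; apply: (nV j).
  by apply: phiV pw _; rewrite cabsC.
apply/nbhs_NoneP; split=> //; exists (rho + 1) => w wr; apply: fixS => j.
by apply/eqP; apply: contrapT => /negP/phi0[_]; rewrite leNgt wr.
Qed.

End perturbation.

(** * Sides of disjoint curves *)

Section sides.
Variable R : realType.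
Local Notation sphere := (riemann_sphere R).
Implicit Types (D K L : set sphere).

Lemma exterior_component D K d : connected D -> D d -> D `<=` ~` K ->
  exterior_domain D K = connected_component (~` K) d.
Proof.
move=> cD Dd DK; apply/seteqP; split=> x.
  by move=> [_ /(_ _ Dd)]; exact: connected_component_sym.
move=> dx; split; first exact: connected_component_sub dx.
by rewrite -(same_connected_component dx); exact: connected_component_max.
Qed.

Section disjoint_curves.
Variable D : set sphere.
Hypotheses (cD : connected D) (D0 : D !=set0).

Lemma open_exterior K : closed K -> D `<=` ~` K -> open (exterior_domain D K).
Proof.
case: D0 => d Dd cK DK; rewrite (exterior_component cD Dd DK).
exact/component_open/closed_openC.
Qed.

Lemma adherent_exterior K L : closed L -> D `<=` ~` L -> K `&` L = set0 ->
  K `<=` closure D -> K `<=` exterior_domain D L.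
Proof.
move=> cL DL KL KD y Ky; have nLy : (~` L) y.
  by move=> Ly; have : (K `&` L) y by []; rewrite KL.
have oC := component_open (p := y) (closed_openC cL).
have yC : connected_component (~` L) y y by exact: connected_component_refl.
have [d [Dd yd]] := KD _ Ky _ (open_nbhs_nbhs (conj oC yC)).
by rewrite (exterior_component cD Dd DL); exact: connected_component_sym.
Qed.

(** A component [Q] of the complement of [L] other than the exterior misses
    [K], and its closure meets [L] because the sphere is connected. As [L] lies
    in the exterior of [K], which is open, so does [Q]. *)
Lemma interiors_disjoint K L : closed K -> closed L -> L !=set0 ->
  D `<=` ~` K -> D `<=` ~` L -> K `&` L = set0 ->
  K `<=` closure D -> L `<=` closure D ->
  forall x, ~ exterior_domain D K x -> ~ exterior_domain D L x -> False.
Proof.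
move=> cK cL [l0 Ll0] DK DL KL KD LD x xK xL.
have KextL := adherent_exterior cL DL KL KD.
have LextK : L `<=` exterior_domain D K.
  by apply: adherent_exterior; rewrite // setIC.
have [d Dd] := D0.
rewrite (exterior_component cD Dd DL) in xL KextL.
have oextK := open_exterior cK DK.
rewrite (exterior_component cD Dd DK) in xK LextK oextK.
have nLx : (~` L) x by move=> /LextK.
set Q := connected_component (~` L) x.
have Qx : Q x by exact: connected_component_refl.
have cQ : connected Q by exact: component_connected.
have QK : Q `<=` ~` K.
  move=> y Qy /KextL yL; apply: xL.
  exact: connected_component_trans yL (connected_component_sym Qy).
have oQ : open Q by exact: component_open (closed_openC cL).
have [l [Ll Ql]] : exists l, L l /\ closure Q l.
  apply: contrapT => nl.
  have clQ : closure Q `<=` Q.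
    apply: connected_component_max; first exact: subset_closure.
      by move=> y Qy Ly; apply: nl; exists y.
    exact: connected_closure.
  have QT : Q = setT.
    apply: (@sphere_connected R); [by exists x|by exists Q; rewrite ?setTI|].
    exists Q; last by rewrite setTI.
    by move=> y /clQ.
  have : Q l0 by rewrite QT.
  by move=> /connected_component_sub.
have [y [Qy yK]] := Ql _ (open_nbhs_nbhs (conj oextK (LextK _ Ll))).
apply: xK; apply: connected_component_trans yK _.
by exists Q => //; split.
Qed.

End disjoint_curves.

Lemma curve_closed K : simple_closed_curve R K -> closed K.
Proof.
move=> [c [cc _ _ <-]]; apply: compact_closed; first exact: sphere_hausdorff.
exact: continuous_compact cc (@segment_compact _ _ _).
Qed.

Lemma curve_nonempty K : simple_closed_curve R K -> K !=set0.
Proof.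
move=> [c [_ _ _ <-]]; exists (c 0), 0 => //.
by rewrite /= in_itv /= lexx ler01.
Qed.

End sides.

(** The letters of a free group: a generator with [true], its inverse with
    [false]. *)
Definition letter_inv (J : Type) (i : J * bool) : J * bool := (i.1, ~~ i.2).

Lemma letter_invK (J : Type) : involutive (@letter_inv J).
Proof. by case=> j b; rewrite /letter_inv /= negbK. Qed.

Section schottky_letters.
Variable R : realType.
Local Notation sphere := (riemann_sphere R).
Local Notation mat := ('M[R[i]^o]_2).

Definition letter_mx (J : Type) (G : J -> mat) (i : J * bool) : mat :=
  if i.2 then G i.1 else \adj (G i.1).

Lemma det_letter_mx (J : Type) (G : J -> mat) i : (forall j, \det (G j) = 1) ->
  \det (letter_mx G i) = 1.
Proof. by rewrite /letter_mx => dG; case: ifP => // _; exact: det_adj. Qed.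

Lemma letter_mxK (J : Type) (G : J -> mat) i p : (forall j, \det (G j) = 1) ->
  mobius (letter_mx G (letter_inv i)) (mobius (letter_mx G i) p) = p.
Proof.
case: i => j [] dG; rewrite /letter_mx /=; first exact: mobius_adjK.
exact: mobius_Kadj.
Qed.

(** A curve together with its interior. *)
Definition schottky_sides (K : bool * bool -> set sphere) (D : set sphere)
  (i : bool * bool) : set sphere := ~` exterior_domain D (K i).

(** A petal lies in its side: [G j] maps the interior of [K (j, true)] onto the
    exterior of [K (j, false)], and, being bijective, the rest into the rest. *)
Lemma schottky_ping_pong (G : bool -> mat) D K1 K2 K3 K4 :
  (forall j, \det (G j) = 1) ->
  schottky_domain R (mobius (G true)) (mobius (G false)) D K1 K2 K3 K4 ->
  exists2 B : bool * bool -> set sphere,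
    ping_pong (@letter_inv bool) (fun i => mobius (letter_mx G i)) B &
    forall i p, D p -> ~ B i p.
Proof.
move=> dG [[C1 C2 C3 C4] [[K12 K13 K14] [K23 K24 K34]] [oD cD bD]].
move=> [_ f12] [_ g34].
pose K (i : bool * bool) : set sphere :=
  if i.1 then (if i.2 then K1 else K2) else (if i.2 then K3 else K4).
have curveK i : simple_closed_curve R (K i) by case: i => [[] []].
have KD i : K i `<=` closure D.
  suff : K i `<=` boundary D by move=> + p Kp => /(_ _ Kp)[].
  by rewrite bD => p; case: i => [[] []]; rewrite /K /=; tauto.
have DK i : D `<=` ~` K i.
  have : K i `<=` boundary D.
    by rewrite bD => p; case: i => [[] []]; rewrite /K /=; tauto.
  by move=> KbD p Dp /KbD[_]; rewrite (interior_id _).1.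
have Kdisj i j : i != j -> K i `&` K j = set0.
  by case: i j => [[] []] [[] []] //= _; rewrite /K //= setIC.
have D0 : D !=set0.
  have [p Kp] := curve_nonempty C1.
  have [d [Dd _]] := KD (true, true) p Kp setT filterT.
  by exists d.
have cK i := curve_closed (curveK i).
exists (schottky_sides K D) => [|i p Dp]; last first.
  apply; rewrite (exterior_component cD Dp (@DK i)).
  by apply: connected_component_refl; exact: DK Dp.
have pairing j : mobius (G j) @` interior_domain D (K (j, true)) =
    exterior_domain D (K (j, false)) by case: j.
split.
- by move=> i; apply: mobius_continuous; exact: det_letter_mx.
- by move=> i p; exact: letter_mxK.
- by move=> i; apply: open_closedC; exact: open_exterior.
- move=> i j x xi xj; apply/eqP; apply: contrapT => /negP ij.
  exact: (interiors_disjoint cD D0 (cK i) (cK j) (curve_nonempty (curveK j))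
    (@DK i) (@DK j) (Kdisj _ _ ij) (@KD i) (@KD j) xi xj).
- move=> [j []] x; rewrite /petal /schottky_sides /letter_inv /letter_mx /=.
    move=> /contrapT; rewrite -pairing => -[y [nKy nDy]].
    move=> /(can_inj (mobius_adjK (dG j))) <- [_ ].
    exact: nDy.
  move=> /contrapT[_ Dx]; rewrite -pairing => -[y [nKy nDy] yx].
  by apply: nDy; rewrite -yx (mobius_adjK (dG j)) in Dx.
Qed.

End schottky_letters.

(** * Stability of Schottky groups *)

Section stability.
Variable R : realType.
Local Notation C := (R[i]^o).
Local Notation sphere := (riemann_sphere R).
Local Notation mat := ('M[R[i]^o]_2).

(** Multiplication by fixed matrices is Lipschitz; [S] bounds their entries. *)
Lemma entry_close_mul (X Y : mat) (e : R) : 0 < e ->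
  exists2 d : R, 0 < d & forall M N : mat, entry_close d M N ->
    entry_close e (X *m M *m Y) (X *m N *m Y).
Proof.
move=> e0; pose S := \sum_i \sum_j (cabs (X i j) + cabs (Y i j)).
have S0 : 0 <= S.
  by apply: sumr_ge0 => i _; apply: sumr_ge0 => j _; rewrite addr_ge0 ?cabs_ge0.
have XS i j : cabs (X i j) <= S /\ cabs (Y i j) <= S.
  have : cabs (X i j) + cabs (Y i j) <= S.
    rewrite /S (bigD1 i)//= (bigD1 j)//= -addrA lerDl addr_ge0//.
      by apply: sumr_ge0 => k _; rewrite addr_ge0 ?cabs_ge0.
    apply: sumr_ge0 => k _; apply: sumr_ge0 => l _.
    by rewrite addr_ge0 ?cabs_ge0.
  have := cabs_ge0 (X i j); have := cabs_ge0 (Y i j); split; lra.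
have K0 : 0 < 4 * (S + 1) ^+ 2 by rewrite mulr_gt0// exprn_gt0// ltr_wpDl.
exists (e / (4 * (S + 1) ^+ 2)); first exact: divr_gt0.
move=> M N MN i j.
have -> : (X *m M *m Y) i j - (X *m N *m Y) i j =
    \sum_k \sum_l X i l * (M l k - N l k) * Y k j :> C.
  rewrite !mxE -sumrB; apply: eq_bigr => k _.
  rewrite !mxE -mulrBl -sumrB mulr_suml; apply: eq_bigr => l _; ring.
apply: le_lt_trans (cabs_sum _) _.
have MNl k l : cabs (X i l * (M l k - N l k) * Y k j) <=
    S ^+ 2 * (e / (4 * (S + 1) ^+ 2)).
  rewrite !cabsM; have [Xl _] := XS i l; have [_ Yk] := XS k j.
  have h1 := ler_pM (cabs_ge0 _) (cabs_ge0 _) Xl (ltW (MN l k)).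
  have h2 := ler_pM (mulr_ge0 (cabs_ge0 _) (cabs_ge0 _)) (cabs_ge0 _) h1 Yk.
  by apply: le_trans h2 _; rewrite le_eqVlt; apply/orP; left; apply/eqP; ring.
have : \sum_k cabs (\sum_l X i l * (M l k - N l k) * Y k j) <=
    \sum_(k : 'I_2) \sum_(l : 'I_2) S ^+ 2 * (e / (4 * (S + 1) ^+ 2)).
  apply: ler_sum => k _; apply: le_trans (cabs_sum _) _.
  by apply: ler_sum => l _; exact: MNl.
move=> /le_lt_trans; apply; rewrite !big_const_ord /= !addr0.
rewrite -[X in _ < X](divfK (lt0r_neq0 K0)) -/(e / _).
have : 0 < e / (4 * (S + 1) ^+ 2) by exact: divr_gt0.
set t := e / _; nra.
Qed.

Section one_group.
Variables (J : finType) (G : J -> mat) (B : J * bool -> set sphere).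
Variable E : set sphere.
Hypothesis dG : forall j, \det (G j) = 1.
Hypothesis GB : ping_pong (@letter_inv J) (fun i => mobius (letter_mx G i)) B.
Hypotheses (cE : closed E) (EB : forall i p, E p -> ~ B i p).

(** The homeomorphism [h0] is the identity on the sides [B (j, true)] and equals
    [G' j \o (G j)^-1] on the sides [B (j, false)]. It transports the ping-pong
    system of [G] to one of [G']. *)
Lemma stability_finite : (forall i, ~ B i None) ->
  exists2 e : R, 0 < e & forall G' : J -> mat, (forall j, \det (G' j) = 1) ->
    (forall j, entry_close e (G' j) (G j)) ->
    exists h : sphere -> sphere,
      [/\ homeomorphism h,
          forall j p, h (mobius (G j) p) = mobius (G' j) (h p) &
          forall p, E p -> \forall q \near p, h q = q].
Proof.
move=> BN; pose K j := B (j, false).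
(* Infinity is kept out of [V j] so that [h0] fixes it. *)
pose V j : set sphere := ~` (E `|` [set None] `|`
  \bigcup_(i in [set i | i != (j, false)]) B i).
have cN : closed [set (None : sphere)].
  by apply: compact_closed; [exact: sphere_hausdorff|exact: compact_set1].
have oV j : open (V j).
  apply: closed_openC; apply: closedU; first exact: closedU.
  apply: closed_bigcup => [|i _]; first exact: finite_finset.
  exact: (pp_closed GB).
have KV j : K j `<=` V j.
  move=> p Kp [[/EB/(_ Kp)//|pN]|[i ij Bp]].
    by apply: (BN (j, false)); rewrite -pN.
  by move: ij; rewrite /= (pp_disj GB Bp Kp) eqxx.
have [e1 e10 pert] := perturbation_homeo
  (fun j => pp_closed GB (i := (j, false))) (fun j => @BN (j, false)) oV KV.
have [e e0 mulP] : exists2 e : R, 0 < e & forall j (M N : mat),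
    entry_close e M N -> entry_close e1 (M *m \adj (G j)) (N *m \adj (G j)).
  have : \forall d \near (0 : R)^'+, forall j (M N : mat),
    entry_close d M N -> entry_close e1 (M *m \adj (G j)) (N *m \adj (G j)).
    apply: filter_forall => j.
    have [d d0 dP] := entry_close_mul 1%:M (\adj (G j)) e10.
    near=> d' => M N MN; have := dP M N; rewrite !mul1mx; apply.
    move=> a b; apply: lt_le_trans (MN a b) _; near: d'.
    exact: nbhs_right_le.
  move=> mulP; have [d [d0 dP]] := filter_ex (filterI (nbhs_right_gt 0) mulP).
  by exists d.
exists e => // G' dG' GG'.
pose M j := G' j *m \adj (G j).
have dM j : \det (M j) = 1 by rewrite det_mulmx dG' det_adj ?mul1r.
have Mclose j : entry_close e1 (M j) 1%:M.
  by have := mulP j _ _ (GG' j); rewrite mul_mx_adj dG.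
have [h0 [k0 [[h0K k0K h0c k0c] [h0M h0V]]]] := pert M dM Mclose.
have ME j p : mobius (M j) (mobius (G j) p) = mobius (G' j) p.
  by rewrite mobiusM ?mobius_adjK// det_adj ?oner_eq0.
have nV j i p : B i p -> i != (j, false) -> ~ V j p.
  by move=> Bp ij; apply; right; exists i.
have h0t j p : B (j, true) p -> h0 p = p.
  move=> Bp; apply: nbhs_singleton (h0V p _) => j'.
  by apply: (nV j' (j, true)) => //; rewrite xpair_eqE andbF.
have h0f j p : B (j, false) (mobius (G j) p) ->
    h0 (mobius (G j) p) = mobius (G' j) p.
  move=> Bp; rewrite (h0M j)// => i Vi; apply/eqP; apply: contrapT => /negP ij.
  by apply: (nV i (j, false) _ Bp _ Vi); apply: contra ij => /eqP[->].
have h0I : injective h0 := can_inj h0K.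
have h0BN : k0 None = None.
  apply: (can_inj h0K); rewrite k0K; apply/esym/(nbhs_singleton (h0V _ _)) => j.
  by apply; left; right.
pose B' i : set sphere := [set p | B i (k0 p)].
pose e' i := mobius (letter_mx G' i).
have B't j p : B' (j, true) p <-> B (j, true) p.
  split=> [Bp|Bp]; first by have := h0t _ _ Bp; rewrite k0K => pE; rewrite pE.
  by rewrite /B' /= -{1}(h0t _ _ Bp) h0K.
have B'f j p :
    B' (j, false) (mobius (G' j) p) <-> B (j, false) (mobius (G j) p).
  split=> [|Bp]; last by rewrite /B' /= -h0f// h0K.
  rewrite /B' /= => Bq; set q := k0 _ in Bq.
  have qE : h0 q = mobius (G' j) (mobius (\adj (G j)) q).
    by rewrite -h0f mobius_Kadj.
  suff -> : p = mobius (\adj (G j)) q by rewrite mobius_Kadj.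
  by apply: (can_inj (mobius_adjK (dG' j))); rewrite -qE k0K.
have petalt j y : petal (@letter_inv J) e' B' (j, true) y <->
    petal (@letter_inv J) (fun i => mobius (letter_mx G i)) B (j, true) y.
  by rewrite /petal /= /e' /letter_mx /=; split=> nB /B'f.
have petalf j y : petal (@letter_inv J) e' B' (j, false) (mobius (M j) y) <->
    petal (@letter_inv J) (fun i => mobius (letter_mx G i)) B (j, false) y.
  rewrite /petal /= /e' /letter_mx /= -{1}[y](mobius_Kadj (dG j)) ME.
  rewrite [X in B' _ X](mobius_adjK (dG' j)).
  by split=> nB /B't.
have h0Mf j x : B (j, false) x -> h0 x = mobius (M j) x.
  by move=> Bx; rewrite -[x](mobius_Kadj (dG j)) ME h0f// mobius_Kadj.
have petalB i y : petal (@letter_inv J) e' B' i y -> B' i y.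
  case: i => j [] /=; first by move=> /petalt/(pp_petal GB); rewrite B't.
  rewrite -[y](mobius_Kadj (dM j)) => /petalf/(pp_petal GB) Bq.
  by rewrite /B' /= -h0Mf// h0K.
have petalE i x : petal (@letter_inv J) e' B' i (h0 x) <->
    petal (@letter_inv J) (fun i => mobius (letter_mx G i)) B i x.
  case: i => j []; split=> [/[dup]/petalB|Ux].
  - by rewrite /B' /= h0K => /h0t -> /petalt.
  - by rewrite (h0t _ _ (pp_petal GB Ux)); apply/petalt.
  - by rewrite /B' /= h0K => /h0Mf -> /petalf.
  - by rewrite (h0Mf _ _ (pp_petal GB Ux)); apply/petalf.
have GB' : ping_pong (@letter_inv J) e' B'.
  split=> //.
  - by move=> i; apply: mobius_continuous; exact: det_letter_mx.
  - by move=> i p; exact: letter_mxK.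
  - move=> i; have /continuous_closedP := k0c; apply; exact: (pp_closed GB).
  - by move=> i j x; exact: (pp_disj GB).
have h0P :
    compatible (@letter_inv J) (fun i => mobius (letter_mx G i)) B e' B' h0.
  split=> //; first by move=> i x; rewrite /B' /= h0K.
  case=> j [] x Bx /contrapT; rewrite /letter_inv /e' /letter_mx /= => Bex.
    by rewrite h0f// (h0t _ _ Bx).
  rewrite (h0t _ _ Bex) (h0Mf _ _ Bx) /M mobiusM ?det_adj ?oner_eq0//.
  exact/esym/(mobius_adjK (dG' j)).
have BN' i : ~ B' i None by rewrite /B' /= h0BN; exact: BN.
have [] := ping_pong_conjugacy (@letter_invK J) (@sphere_compact R)
  (@sphere_hausdorff R) GB GB'
  (mobius_shrinking (@letter_invK J) (fun i => det_letter_mx i dG) GB BN)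
  (mobius_shrinking (@letter_invK J) (fun i => det_letter_mx i dG') GB' BN')
  h0K k0K h0P k0c.
move=> h [hh he hcore]; exists h; split=> //.
  by move=> j p; exact: (he (j, true)).
move=> p Ep; have nB : \forall q \near p, forall i, ~ B i q.
  apply: (@filter_forall _ _ (fun i => ~` B i) _ (nbhs_filter p)) => i.
  apply: (@open_nbhs_nbhs _ _ (~` B i)); split; last exact: EB.
  exact: closed_openC (pp_closed GB (i := i)).
have h0E : \forall q \near p, h0 q = q by apply: h0V => j; apply; left; left.
apply: filterS (filterI nB h0E) => q [nBq h0q].
by rewrite hcore// => i /(pp_petal GB)/nBq.
Unshelve. all: by end_near. Qed.

End one_group.

(** In general a Moebius transformation [N] takes a point of the fundamental
    region to infinity. *)
Lemma schottky_stability (J : finType) (G : J -> mat)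
    (B : J * bool -> set sphere) (E : set sphere) :
  (forall j, \det (G j) = 1) ->
  ping_pong (@letter_inv J) (fun i => mobius (letter_mx G i)) B ->
  closed E -> (forall i p, E p -> ~ B i p) -> (exists p, forall i, ~ B i p) ->
  exists2 e : R, 0 < e & forall G' : J -> mat, (forall j, \det (G' j) = 1) ->
    (forall j, entry_close e (G' j) (G j)) ->
    exists h : sphere -> sphere,
      [/\ homeomorphism h,
          forall j p, h (mobius (G j) p) = mobius (G' j) (h p) &
          forall p, E p -> \forall q \near p, h q = q].
Proof.
move=> dG GB cE EB [p0 Bp0]; have [N dN Np0] := mobius_to_None p0.
pose conj (X : mat) := N *m X *m \adj N.
have dconj X : \det X = 1 -> \det (conj X) = 1.
  by move=> dX; rewrite !det_mulmx dN dX det_adj// !mulr1.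
have conjE X p : \det X = 1 ->
    mobius (conj X) p = mobius N (mobius X (mobius (\adj N) p)).
  by move=> dX; rewrite !mobiusM ?det_adj ?dX ?oner_eq0.
pose e i := mobius (letter_mx G i).
pose eN i := mobius (letter_mx (conj \o G) i).
have eNE i p : eN i p = mobius N (e i (mobius (\adj N) p)).
  case: i => j []; rewrite /eN /e /letter_mx /= ?conjE//.
  apply: (can_inj (mobius_adjK (dconj _ (dG j)))).
  by rewrite mobius_Kadj ?dconj// conjE// mobius_adjK// !mobius_Kadj.
pose BN i : set sphere := mobius (\adj N) @^-1` B i.
have cadjN := mobius_continuous (det_adj dN).
have cpre (A : set sphere) : closed A -> closed (mobius (\adj N) @^-1` A).
  by move=> cA; have /continuous_closedP := cadjN; exact.
have dGN j : \det ((conj \o G) j) = 1 by exact: dconj.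
have GBN : ping_pong (@letter_inv J) eN BN.
  split.
  - by move=> i; apply: mobius_continuous; exact: det_letter_mx.
  - by move=> i p; exact: letter_mxK.
  - by move=> i; apply: cpre; exact: (pp_closed GB).
  - by move=> i j x; exact: (pp_disj GB).
  - move=> i x; rewrite /petal /BN /= eNE mobius_adjK// => Ux.
    exact: (pp_petal GB) Ux.
have EBN i p : (mobius (\adj N) @^-1` E) p -> ~ BN i p by exact: EB.
have N0 : mobius (\adj N) None = p0 by rewrite -Np0 mobius_adjK.
have BNN i : ~ BN i None by rewrite /BN /preimage /mkset N0.
have [d d0 dP] := stability_finite dGN GBN (cpre _ cE) EBN BNN.
have [e1 e10 e1P] := entry_close_mul N (\adj N) d0.
exists e1 => // G' dG' GG'.
have [j|j|h [[k [hK kK hc kc]] hG hE]] := dP (conj \o G').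
- exact: dconj.
- exact: e1P.
have cN := mobius_continuous dN.
exists (mobius (\adj N) \o h \o mobius N); split.
- exists (mobius (\adj N) \o k \o mobius N); split.
  + by move=> p /=; rewrite mobius_Kadj// hK mobius_adjK.
  + by move=> p /=; rewrite mobius_Kadj// kK mobius_adjK.
  + move=> p; apply: continuous_comp; first exact: cN.
    by apply: continuous_comp; [exact: hc|exact: cadjN].
  + move=> p; apply: continuous_comp; first exact: cN.
    by apply: continuous_comp; [exact: kc|exact: cadjN].
- move=> j p /=; have := hG j (mobius N p).
  rewrite /= !conjE// mobius_adjK// => ->.
  by rewrite mobius_adjK.
- move=> p Ep; have := hE (mobius N p).
  rewrite /preimage /mkset mobius_adjK// => /(_ Ep)/cN hN.
  change (\forall q \near p, mobius (\adj N) (h (mobius N q)) = q).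
  have {}hN : nbhs p (mobius N @^-1` [set q | h q = q]) := hN.
  by apply: filterS hN => q /= hq; rewrite hq mobius_adjK.
Qed.

End stability.

(** * Structural stability *)

Section structural_stability.
Variable R : realType.
Local Notation sphere := (riemann_sphere R).
Local Notation mat := ('M[R[i]^o]_2).
Local Notation SL := (@sl2 R).
Local Open Scope quotient_scope.

(** The set where [h] preserves the membership in [A] is open and closed: near
    the boundary of [A] because [h] is the identity there, elsewhere because
    neither [x] nor [h x] is on the boundary. *)
Lemma fix_boundary_preserves (A E : set sphere) (h : sphere -> sphere) :
  injective h -> continuous h -> boundary A `<=` E -> E !=set0 ->
  (forall p, E p -> \forall q \near p, h q = q) -> forall p, A (h p) <-> A p.
Proof.
move=> hI hc AE [x0 Ex0] hE; pose S := [set p | A (h p) <-> A p].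
have side (p : sphere) : ~ E p ->
    (\forall q \near p, A q) \/ (\forall q \near p, ~ A q).
  move=> nE; have [Ap|nA] := pselect (closure A p); [left|right].
    by apply: contrapT => nAi; apply/nE/AE; split.
  have : nbhs p (~` closure A).
    by apply: open_nbhs_nbhs; split=> //; exact/closed_openC/closed_closure.
  by apply: filterS => q; apply: contra_not; exact: subset_closure.
have loc (p : sphere) : (\forall q \near p, S q) \/ (\forall q \near p, ~ S q).
  have [Ep|nE] := pselect (E p).
    by left; apply: filterS (hE _ Ep) => q; rewrite /S /= => ->.
  have nEh : ~ E (h p).
    by move=> Ehp; apply: nE; rewrite -(hI _ _ (nbhs_singleton (hE _ Ehp))).
  have hh (P : set sphere) : nbhs (h p) P -> nbhs p (h @^-1` P) by exact: hc.
  have [pA|pA] := side _ nE; have [/hh hA|/hh hA] := side _ nEh.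
  - by left; apply: filterS (filterI hA pA) => q /= [].
  - by right; apply: filterS (filterI hA pA) => q /= []; rewrite /S /=; tauto.
  - by right; apply: filterS (filterI hA pA) => q /= []; rewrite /S /=; tauto.
  - by left; apply: filterS (filterI hA pA) => q /= []; rewrite /S /=; tauto.
have oS : open S.
  rewrite openE => p Sp; case: (loc p) => // nS.
  by have := nbhs_singleton nS.
have cS : closed S.
  rewrite -[S]setCK; apply: open_closedC; rewrite openE => p Sp.
  by case: (loc p) => // /nbhs_singleton/Sp.
have ST : S = setT.
  apply: (@sphere_connected R).
  - by exists x0; rewrite /S /= (nbhs_singleton (hE _ Ex0)).
  - by exists S; rewrite ?setTI.
  - by exists S; rewrite ?setTI.
by move=> p; have : S p by rewrite ST.
Qed.

Lemma open_entry_close (A : mat) (e : R) : open [set M | entry_close e M A].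
Proof.
rewrite openE => M MA.
exists (fun i j => [set z | cabs (z - A i j) < e]) => [i j|N NA] //.
apply/nbhs_planeP; exists (e - cabs (M i j - A i j)); first by rewrite subr_gt0.
move=> w wM /=; have := cabs_dist w (A i j) (M i j); move: wM; lra.
Qed.

Lemma entry_closeN (A M : mat) (e : R) :
  entry_close e (- M) A <-> entry_close e M (- A).
Proof.
have E i j : (- M) i j - A i j = - (M i j - (- A) i j) by rewrite !mxE; ring.
by split=> MA i j; have := MA i j; rewrite E cabsN.
Qed.

Lemma sl2N (A : SL) : exists A' : SL, set_val A' = - set_val A.
Proof.
have dA : \det (set_val A) = 1 by have := set_mem (valP A).
suff dN : (- set_val A) \in SL by exists (exist (fun M : mat => M \in SL) _ dN).
by apply/mem_set; rewrite /sl2 /= det2 !mxE !mulrNN -det2.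
Qed.

(** The saturation of a ball of matrices is its union with the opposite ball,
    hence open. *)
Lemma psl2_near (p : psl2 R) (e : R) : 0 < e ->
  \forall q \near p, exists2 A : SL, \pi_(psl2 R) A = q &
    entry_close e (set_val A) (set_val (repr p : SL)).
Proof.
move=> e0; pose A0 := repr p : SL.
pose W := [set q : psl2 R | exists2 A : SL, \pi_(psl2 R) A = q &
  entry_close e (set_val A) (set_val A0)].
have oW : open W.
  change (open (\pi_(psl2 R) @^-1` W)).
  have -> : \pi_(psl2 R) @^-1` W = set_val @^-1`
      ([set M | entry_close e M (set_val A0)] `|`
       [set M | entry_close e M (- set_val A0)]).
    apply/seteqP; split=> A.
      move=> [A' /eqmodP/orP[]/eqP A'E A'e]; rewrite A'E in A'e; first by left.
      by right; exact/entry_closeN.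
    case=> Ae; first by exists A.
    have [A' A'E] := sl2N A; exists A'.
      by apply/eqmodP; rewrite /= /sl2_eqpm A'E eqxx orbT.
    by rewrite A'E; exact/entry_closeN.
  have /continuousP := @initial_continuous SL _ set_val; apply.
  by apply: openU; exact: open_entry_close.
apply: (@open_nbhs_nbhs _ _ W); split=> //; exists A0; first exact: reprK.
by move=> i j; rewrite subrr cabs0.
Qed.

Lemma pw_fstP (R1 R2 : set sphere) (F : pw_mobius R1 R2) z :
  R1 z -> F z = pw_fst F z.
Proof. exact: (svalP (cid (pw_funP F))).1. Qed.

Lemma pw_sndP (R1 R2 : set sphere) (F : pw_mobius R1 R2) z :
  R2 z -> F z = pw_snd F z.
Proof. exact: (svalP (cid (pw_funP F))).2. Qed.

End structural_stability.

Theorem theorem6 (R : realType) (dR R1 R2 : set (riemann_sphere R))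
    (dR_curve : simple_closed_curve R dR)
    (dR_partition : partition_along R dR R1 R2)
    (F : pw_mobius R1 R2)
    (F_schottky : schottky F)
    (dR_fundamental : exists2 D, fundamental_region F D & dR `<=` D) :
  structurally_stable F.
Proof.
have [D [K1 [K2 [K3 [K4 FD]]]] dRD] := dR_fundamental.
have [R12 _ Rbd] := dR_partition.
have [_ _ bd1] := Rbd R1 (or_introl erefl).
have [_ _ bd2] := Rbd R2 (or_intror erefl).
have dR0 := curve_nonempty dR_curve.
pose lift (A1 A2 : @sl2 R) (j : bool) := if j then set_val A1 else set_val A2.
have det_lift A1 A2 j : \det (lift A1 A2 j) = 1.
  by case: j; [have := set_mem (valP A1)|have := set_mem (valP A2)].
pose p := pw_pieces F.
have dG := det_lift (repr p.1) (repr p.2).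
have [B GB DB] := schottky_ping_pong dG FD.
have [e e0 stab] := schottky_stability dG GB (curve_closed dR_curve)
  (fun i p Ep => DB i p (dRD _ Ep))
  (let: ex_intro x Ex := dR0 in ex_intro _ x (fun i => DB i x (dRD _ Ex))).
pose close (q : psl2 R) (q' : psl2 R) := exists2 A : @sl2 R,
  \pi_(psl2 R)%qT A = q' & entry_close e (set_val A) (set_val (repr q : @sl2 R)).
exists [set F' : pw_mobius R1 R2 |
    close p.1 (pw_pieces F').1 /\ close p.2 (pw_pieces F').2].
  apply: (@initial_continuous _ _ (@pw_pieces R R1 R2) F
    [set q | close p.1 q.1 /\ close p.2 q.2]).
  exists ([set q | close p.1 q], [set q | close p.2 q]).
    by split; exact: psl2_near.
  by move=> q [].
move=> F' [[A1 A1E A1e] [A2 A2E A2e]].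
have [|[]//|h [hh hG hE]] := stab (lift A1 A2).
- exact: det_lift.
exists h => //; have [k [hK _ hc _]] := hh.
have hR1 := fix_boundary_preserves (can_inj hK) hc _ dR0 hE.
have hR i x : boundary i = dR -> i (h x) <-> i x.
  by move=> ib; apply: (hR1 i); rewrite ib.
have f'E : pw_fst F' = mobius (set_val A1) by rewrite /pw_fst -A1E psl2_funE.
have g'E : pw_snd F' = mobius (set_val A2) by rewrite /pw_snd -A2E psl2_funE.
apply/funext => x /=; have [R1x|R2x] : (R1 `|` R2) x by rewrite R12.
  rewrite (pw_fstP F R1x) (pw_fstP F') ?f'E; first exact/esym/(hG true).
  exact/hR.
rewrite (pw_sndP F R2x) (pw_sndP F') ?g'E; first exact/esym/(hG false).
exact/hR.
Qed.
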